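(* For every constant $a>0$ there is a constant $C_a>0$ depending only on $a$ such that the following holds. Let $\mathcal H$ be a real Hilbert space, let $T:\mathcal H\to\mathcal H$ be nonexpansive with $\operatorname{Fix}T=\{x: Tx=x\}\ne\varnothing$, let $x_0,x_1\in\mathcal H$ be deterministic, put $D=\inf_{p^\star\in\operatorname{Fix}T}\|x_1-p^\star\|$, and let $\sigma\ge0$, $B\ge0$ with $\sigma+B>0$. Then there is $\epsilon_0>0$ (depending on $a,D,\sigma,B$) such that for every $0<\epsilon\le\epsilon_0$ and every integer $K\ge2$ with $a\le\frac{K\log2}{\log K}-1$ and $$K\ \ge\ C_a\left(\frac{D}{\epsilon}+\frac{(\sigma+B)^2}{\epsilon^2}\log^2\!\left(\frac{\sigma+B}{\epsilon}\right)\right),$$ the points $x_K,y_K,z_K$ generated by the stochastic iKM iteration with the softplus-parameterized schedule with parameter $a$ (both defined in the context), under the stochastic oracle model of the context with noise level $\sigma$ and accumulated root-mean-square bias $B_K\le B\sqrt K$, satisfy $$\max_{v_K\in\{x_K,y_K,z_K\}}\left(\mathbb E\|v_K-Tv_K\|^2\right)^{1/2}\le\epsilon .$$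
   Context: Nonexpansive means $\|Tx-Ty\|\le\|x-y\|$ for all $x,y\in\mathcal H$. Stochastic iKM iteration (one oracle call per iteration): for $k=1,\dots,K$, $$y_k=x_k+\alpha_k(x_k-x_{k-1}),\quad z_k=x_k+\beta_k(x_k-x_{k-1}),\quad x_{k+1}=(1-\lambda_k)y_k+\lambda_k\widehat T_k(z_k).$$ Stochastic oracle model: $\widehat T_k(z_k)=Tz_k+b_k+\xi_k$. There is a probability space with a filtration $(\mathcal F_k)_{k=1}^K$, $\mathcal F_k\subseteq\mathcal F_{k+1}$; all $\mathcal H$-valued random variables are strongly measurable. For $1\le k\le K-1$: $x_{k-1},x_k,y_k,z_k$ and the bias $b_k$ are $\mathcal F_k$-measurable, and $\xi_k$ (hence $\widehat T_k(z_k)$) is $\mathcal F_{k+1}$-measurable. The noise satisfies $\mathbb E[\xi_k\mid\mathcal F_k]=0$ and $\mathbb E[\|\xi_k\|^2\mid\mathcal F_k]\le\sigma^2$ almost surely, for $1\le k\le K$. The accumulated root-mean-square bias is $B_K=\sum_{k=1}^{K-1}(\mathbb E\|b_k\|^2)^{1/2}$. Softplus-parameterized schedule with parameter $a$: $$\omega_k=\log\left(1+K^{a-(a+1)k/K}\right)\ (0\le k\le K),$$ $$r_k=2\left(\frac{\omega_{k-1}}{\omega_k}-1\right),\qquad u_k=\frac{3r_k}{2(1+r_k)(2+r_k)}\quad(1\le k\le K),$$ $$\beta_1=0,\quad \beta_k=\frac{4}{3r_{k-1}}\ (2\le k\le K),\qquad \lambda_k=\frac{K r_k\omega_{k-1}}{4(1+1/a)\omega_0}\,u_k,\quad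 \alpha_k=\frac{u_k-\lambda_k}{1-\lambda_k}\,\beta_k\quad(1\le k\le K).$$ *)

(* Defs.v *)
(* Written with MathComp and MathComp-Analysis. *)
From HB Require Import structures.
From mathcomp Require Import all_boot all_order all_algebra.
From mathcomp Require Import all_classical all_reals all_analysis.

Set Implicit Arguments.
Unset Strict Implicit.
Unset Printing Implicit Defensive.
Import Order.TTheory GRing.Theory Num.Theory.
Import numFieldNormedType.Exports.

Local Open Scope classical_set_scope.
Local Open Scope ring_scope.

Definition nonexpansive (R : realType) (H : normedModType R) (T : H -> H) :=
  forall x y : H, `|T x - T y| <= `|x - y|.

Definition Fix (H : Type) (T : H -> H) : set H := [set x | T x = x].

Section vector_valued_random_variables.
Context (d : measure_display) (Omega : measurableType d) (R : realType)
  (H : normedModType R) (P : probability Omega R).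
Implicit Types (G : set (set Omega)) (A : set Omega) (X Y s : Omega -> H).

Definition simple_rv G s :=
  finite_set (range s) /\ forall h : H, G (s @^-1` [set h]).

(* Strong measurability with respect to the sigma-algebra G. *)
Definition strongly_measurable G X :=
  exists s : nat -> Omega -> H,
    (forall n, simple_rv G (s n)) /\
    (forall w, s n w @[n --> \oo] --> X w).

Definition simple_integral A s : H :=
  \sum_(h \in range s) fine (P (A `&` s @^-1` [set h])) *: h.

(* "X is Bochner integrable on A with Bochner integral v". *)
Definition is_bochner_integral A X (v : H) :=
  strongly_measurable measurable X /\
  exists s : nat -> Omega -> H,
    [/\ forall n, simple_rv measurable (s n),
        (\int[P]_(w in A) `|X w - s n w|%:E)%E @[n --> \oo] --> 0%E &
        simple_integral A (s n) @[n --> \oo] --> v].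

(* "Y is a version of E[X | G]"; the case A = Omega makes X and Y Bochner
   integrable. *)
Definition is_cond_exp G X Y :=
  strongly_measurable G Y /\
  forall A, G A ->
    exists v : H, is_bochner_integral A X v /\ is_bochner_integral A Y v.

(* (E ||X||^2)^(1/2), as an extended real. *)
Definition rms X : \bar R := sqrte 'E_P[fun w => `|X w| ^+ 2].

End vector_valued_random_variables.

(* "g is a version of E[f | G]" for real-valued f. *)
Definition is_real_cond_exp (d : measure_display) (Omega : measurableType d)
    (R : realType) (P : probability Omega R) (G : set (set Omega))
    (f g : Omega -> R) :=
  [/\ P.-integrable setT (EFin \o f), P.-integrable setT (EFin \o g),
      measurable_fun setT (g : g_sigma_algebraType G -> R) &
      forall A, G A ->
        (\int[P]_(w in A) (f w)%:E = \int[P]_(w in A) (g w)%:E)%E].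

Section softplus_schedule.
Context (R : realType) (a : R) (K : nat).

Definition sp_omega (k : nat) : R :=
  ln (1 + K%:R `^ (a - (a + 1) * k%:R / K%:R)).

Definition sp_r (k : nat) : R := 2 * (sp_omega k.-1 / sp_omega k - 1).

Definition sp_u (k : nat) : R :=
  3 * sp_r k / (2 * (1 + sp_r k) * (2 + sp_r k)).

Definition sp_beta (k : nat) : R :=
  if (k <= 1)%N then 0 else 4 / (3 * sp_r k.-1).

Definition sp_lambda (k : nat) : R :=
  K%:R * sp_r k * sp_omega k.-1 / (4 * (1 + 1 / a) * sp_omega 0) * sp_u k.

Definition sp_alpha (k : nat) : R :=
  (sp_u k - sp_lambda k) / (1 - sp_lambda k) * sp_beta k.

End softplus_schedule.

(* The k-th oracle answer, written \hat T_k(z_k) on paper, is the random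
   variable [That k]; how it depends on z_k is specified by [oracle_model]. *)
Definition ikm_iteration (R : realType) (H : normedModType R) (Omega : Type)
    (alpha beta lambda : nat -> R) (K : nat) (x0 x1 : H)
    (x y z That : nat -> Omega -> H) :=
  [/\ forall w, x 0%N w = x0,
      forall w, x 1%N w = x1 &
      forall k, (1 <= k <= K)%N -> forall w,
        [/\ y k w = x k w + alpha k *: (x k w - x k.-1 w),
            z k w = x k w + beta k *: (x k w - x k.-1 w) &
            x k.+1 w = (1 - lambda k) *: y k w + lambda k *: That k w]].

Record oracle_model (d : measure_display) (Omega : measurableType d)
    (R : realType) (H : normedModType R) (P : probability Omega R)
    (T : H -> H) (sigma : R) (K : nat) (F : nat -> set (set Omega))
    (x y z That b xi : nat -> Omega -> H) : Prop := OracleModel {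
  oracle_answer : forall k, (1 <= k <= K)%N -> forall w,
    That k w = T (z k w) + b k w + xi k w ;
  filtration_sigma : forall k, (1 <= k <= K)%N ->
    sigma_algebra setT (F k) /\ F k `<=` measurable ;
  filtration_mono : forall k, (1 <= k < K)%N -> F k `<=` F k.+1 ;
  all_measurable : forall k, (1 <= k <= K)%N ->
    [/\ strongly_measurable measurable (x k.-1),
        strongly_measurable measurable (x k) &
        strongly_measurable measurable (x k.+1)] /\
    [/\ strongly_measurable measurable (y k),
        strongly_measurable measurable (z k),
        strongly_measurable measurable (That k),
        strongly_measurable measurable (b k) &
        strongly_measurable measurable (xi k)] ;
  adapted : forall k, (1 <= k <= K.-1)%N ->
    [/\ strongly_measurable (F k) (x k.-1),
        strongly_measurable (F k) (x k),
        strongly_measurable (F k) (y k),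
        strongly_measurable (F k) (z k) &
        strongly_measurable (F k) (b k)] ;
  noise_adapted : forall k, (1 <= k <= K.-1)%N ->
    strongly_measurable (F k.+1) (xi k) /\
    strongly_measurable (F k.+1) (That k) ;
  noise_unbiased : forall k, (1 <= k <= K)%N ->
    is_cond_exp P (F k) (xi k) (fun=> 0) ;
  noise_variance : forall k, (1 <= k <= K)%N ->
    exists g : Omega -> R,
      is_real_cond_exp P (F k) (fun w => `|xi k w| ^+ 2) g /\
      {ae P, forall w, g w <= sigma ^+ 2}
}.

(* B_K *)
Definition total_rms_bias (d : measure_display) (Omega : measurableType d)
    (R : realType) (H : normedModType R) (P : probability Omega R) (K : nat)
    (b : nat -> Omega -> H) : \bar R :=
  (\sum_(1 <= k < K) rms P (b k))%E.

(* Main.v *)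
Require Import Defs.
From HB Require Import structures.
From mathcomp Require Import all_boot all_order all_algebra.
From mathcomp Require Import all_classical all_reals all_analysis.
From mathcomp Require Import finmap measurable_realfun ring lra.

Set Implicit Arguments.
Unset Strict Implicit.
Unset Printing Implicit Defensive.
Import Order.TTheory GRing.Theory Num.Theory.
Import numFieldNormedType.Exports.

Local Open Scope classical_set_scope.
Local Open Scope ring_scope.

(** Put [G = I - T], [c = K / (4 (1 + 1/a) omega_0)] and
    [n_k = beta_k / omega_(k-1) (x_k - x_(k-1))].  The schedule turns the
    iteration into [z_k = x_k + omega_(k-1) n_k],
    [(1 + r_k) n_(k+1) = n_k - r_k (c G z_k - c (b_k + xi_k))] and
    [x_(k+1) = x_k + 3/4 r_k omega_k n_(k+1)].

    Since [G z_k] reacts at first order to the noise of the previous step, the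
    energy is not measured at [z_k] but at the resolvent point [v_k] given by
    [v_k + omega_(k-1) c G v_k = x_k], which moves smoothly.  With
    [g_k = c G v_k], monotonicity of [G] shows that
    [|n_k + g_k|^2 / 2 + |g_k|^2 / 6] does not increase without noise; noise
    adds a term linear in it, which has zero mean up to the bias, and a
    quadratic one of size [r_k^2 c^2].  As [r_k = O(log K / K)], and as the
    initial energy is at most [(D / omega_0)^2], the root of the final mean
    energy divided by [c] is [O(D / K + (sigma + B) log K / sqrt K)].  Finally
    [c omega_(K-1) <= 1], so this energy controls the residuals at [x_K], [y_K]
    and [z_K]. *)

(** * Inner product geometry *)

Section inner_product.
Context (R : realType) (H : normedModType R) (dot : {dot H for @idfun R}).
Hypothesis dotE : forall h : H, `|h| ^+ 2 = dot h h.
Implicit Types u v w : H.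

Lemma dotC u v : dot u v = dot v u.
Proof. by rewrite [LHS](hermC (eps := false)) expr0 mul1r. Qed.

Lemma dotDr u v w : dot u (v + w) = dot u v + dot u w.
Proof. exact: linearD. Qed.

Lemma dotZr a u v : dot u (a *: v) = a * dot u v.
Proof. exact: linearZ. Qed.

Lemma dotNr u v : dot u (- v) = - dot u v.
Proof. exact: linearN. Qed.

Lemma dot0r u : dot u 0 = 0.
Proof. exact: linear0. Qed.

Lemma dotDl u v w : dot (v + w) u = dot v u + dot w u.
Proof. by rewrite dotC dotDr !(dotC u). Qed.

Lemma dotZl a u v : dot (a *: v) u = a * dot v u.
Proof. by rewrite dotC dotZr dotC. Qed.

Lemma dotNl u v : dot (- v) u = - dot v u.
Proof. by rewrite dotC dotNr dotC. Qed.

(** Vector identities below are proved by pairing both sides with an arbitrary vector, which leaves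
    a real identity for [ring] or [field]. *)
Lemma dot_inj u v : (forall w, dot u w = dot v w) -> u = v.
Proof.
move=> uv; apply/eqP; rewrite -subr_eq0 -normr_eq0 -sqrf_eq0 dotE.
by rewrite dotDl dotNl uv subrr.
Qed.

Definition dot_lin := (dotDl, dotDr, dotZl, dotZr, dotNl, dotNr).

Lemma normD_sqr u v : `|u + v| ^+ 2 = `|u| ^+ 2 + 2 * dot u v + `|v| ^+ 2.
Proof. by rewrite !dotE !dot_lin (dotC v u); ring. Qed.

Lemma normB_sqr u v : `|u - v| ^+ 2 = `|u| ^+ 2 - 2 * dot u v + `|v| ^+ 2.
Proof. by rewrite !dotE !dot_lin (dotC v u); ring. Qed.

Lemma dot_le_norm u v : `|dot u v| <= `|u| * `|v|.
Proof.
have [->|u0] := eqVneq u 0; first by rewrite dotC dot0r normr0 normr0 mul0r.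
have nu : 0 < `|u| by rewrite normr_gt0.
rewrite -(@ler_pXn2r _ 2) ?nnegrE ?mulr_ge0// real_normK ?num_real// exprMn.
(* Up to the factor [|u|^2], the squared norm of this vector is [|u|^2 |v|^2 - (dot u v)^2]. *)
have := sqr_ge0 `|(`|u| ^+ 2) *: v - dot u v *: u|.
rewrite normB_sqr !normrZ !exprMn !dot_lin (dotC v u) normr_id.
rewrite real_normK ?num_real//; move: nu; move: (`|u|) (`|v|) (dot u v) => p q s p0.
by rewrite -[_ <= p ^+ 2 * q ^+ 2](ler_pM2l (exprn_gt0 2 p0)); nra.
Qed.

Lemma normD_sqr_le u v : `|u + v| ^+ 2 <= 2 * (`|u| ^+ 2 + `|v| ^+ 2).
Proof.
have := sqr_ge0 `|u - v|; rewrite normB_sqr normD_sqr; lra.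
Qed.

Section residual.
Context (T : H -> H).
Hypothesis neT : nonexpansive T.

(** With [G = I - T], expand the square of [T x - T y = (x - y) - (G x - G y)] and compare with
    [|x - y|^2]. In particular [G] is monotone. *)
Lemma residual_cocoercive x y :
  `|(x - T x) - (y - T y)| ^+ 2 <= 2 * dot ((x - T x) - (y - T y)) (x - y).
Proof.
have : `|T x - T y| ^+ 2 <= `|x - y| ^+ 2.
  by rewrite ler_pXn2r ?nnegrE//; exact: neT.
have -> : T x - T y = (x - y) - ((x - T x) - (y - T y)).
  by apply: dot_inj => w; rewrite !dot_lin; ring.
by rewrite normB_sqr dotC; lra.
Qed.

Lemma residual_lipschitz x y : `|(x - T x) - (y - T y)| <= 2 * `|x - y|.
Proof.
rewrite opprD addrACA (le_trans (ler_normD _ _))// mulr2n mulrDl mul1r lerD2l.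
by rewrite -opprB normrN opprK addrC (le_trans _ (neT x y)) // addrC.
Qed.

End residual.
End inner_product.

(** * Resolvents of the residual operator *)

Section resolvent.
Context (R : realType) (H : completeNormedModType R) (T : H -> H).
Hypothesis neT : nonexpansive T.

(** The equation says that [v] is fixed by [v |-> (x + mu T v) / (1 + mu)], a contraction with
    factor [mu / (1 + mu)]. *)
Lemma resolvent_exists (mu : R) : 0 <= mu ->
  exists J : H -> H, forall x, J x + mu *: (J x - T (J x)) = x.
Proof.
move=> mu0; have mu1 : 0 < 1 + mu by lra.
suff exJ x : exists v, v + mu *: (v - T v) = x.
  by have [J ?] := boolp.choice exJ; exists J.
pose f v := (1 + mu)^-1 *: (x + mu *: T v).
have q0 : 0 <= mu / (1 + mu) by rewrite divr_ge0 ?(ltW mu1).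
have ctr : is_contraction (totalfun f : {fun setT >-> setT}).
  exists (NngNum q0); split=> /=; first by rewrite ltr_pdivrMr// mul1r; lra.
  move=> -[u v] _ /=; rewrite /f -scalerBr opprD addrACA subrr add0r -scalerBr.
  rewrite scalerA normrZ ger0_norm; last by rewrite mulr_ge0// invr_ge0 ltW.
  by rewrite (mulrC _ mu) ler_wpM2l//; exact: neT.
have [|v _ fv] := banach_fixed_point ctr closedT; first by exists x.
exists v; move: fv; rewrite /= /totalfun /f => fv.
have : (1 + mu) *: v = x + mu *: T v.
  by rewrite {1}fv scalerA mulfV ?scale1r// gt_eqF.
rewrite scalerDl scale1r => /eqP; rewrite -subr_eq => /eqP <-.
by rewrite scalerBr addrA.
Qed.

End resolvent.

(** * Descent of the energy in one step *)

Section descent.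
Context (R : realType) (H : normedModType R) (dot : {dot H for @idfun R}).
Hypothesis dotE : forall h : H, `|h| ^+ 2 = dot h h.
Context (T : H -> H).
Hypothesis neT : nonexpansive T.

Definition potential (n g : H) : R := `|n + g| ^+ 2 / 2 + `|g| ^+ 2 / 6.

(** Monotonicity of [I - T] makes the cross term of the expanded square nonnegative. This continuity
    later carries measurability from the iterates to the resolvent points. *)
Lemma resolvent_lipschitz (mu : R) (x y v w : H) : 0 <= mu ->
  v + mu *: (v - T v) = x -> w + mu *: (w - T w) = y -> `|v - w| <= `|x - y|.
Proof.
move=> mu0 <- <-; rewrite -(@ler_pXn2r _ 2) ?nnegrE//.
have -> : v + mu *: (v - T v) - (w + mu *: (w - T w)) =
    (v - w) + mu *: ((v - T v) - (w - T w)).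
  by apply: (dot_inj dotE) => h; rewrite !(dot_lin dot); ring.
rewrite (normD_sqr dotE (v - w)) (dotZr dot) normrZ exprMn.
have := residual_cocoercive dotE neT v w; rewrite (dotC dot).
have := sqr_ge0 `|v - T v - (w - T w)|.
have := sqr_ge0 `|mu|; move: (_ ^+ 2) (_ ^+ 2) (dot _ _) => p q s p0 q0 qs.
by have := mulr_ge0 p0 q0; have : 0 <= mu * s; [apply: mulr_ge0 => //|]; lra.
Qed.

Lemma norm_step_le (r : R) (W D : H) : 0 < r ->
  r / 2 * `|D| ^+ 2 <= dot D W -> `|W - r *: D| ^+ 2 <= `|W| ^+ 2.
Proof.
move=> r0 DW.
rewrite (normB_sqr dotE) (dotZr dot) normrZ exprMn (dotC dot) gtr0_norm//.
nra.
Qed.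

(** One step in abstract form: [W] and [Y] stand for [n_k + g_k] and [n_(k+1) + g_k], [G] for [g_k],
    [F] for the increment of [g_k], [D] for [c (z_k - T z_k) - g_k] and [e] for the scaled error.
    Once expanded, only squared norms and inner products remain. *)
Lemma descent_gram (r : R) (W D e Y G F : H) : 0 < r <= 1 ->
  r / 2 * `|D| ^+ 2 <= dot D W ->
  (1 + r) *: Y = W - r *: D + r *: e ->
  `|F| ^+ 2 <= dot F ((3 / 4 * r) *: Y - (r / 4) *: G) ->
  `|Y + F| ^+ 2 / 2 + `|G + F| ^+ 2 / 6 <=
    `|W| ^+ 2 / 2 + `|G| ^+ 2 / 6 + r * dot e (W - r *: D)
    + r ^+ 2 * `|e| ^+ 2 / 2.
Proof.
move=> /andP[r0 r1] DW YE FG.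
have UW := norm_step_le r0 DW.
have YU : (1 + r) ^+ 2 * `|Y| ^+ 2 =
    `|W - r *: D| ^+ 2 + 2 * (r * dot e (W - r *: D)) + r ^+ 2 * `|e| ^+ 2.
  have -> : (1 + r) ^+ 2 * `|Y| ^+ 2 = `|(1 + r) *: Y| ^+ 2.
    by rewrite normrZ exprMn real_normK// num_real.
  rewrite YE (normD_sqr dotE (W - r *: D)) (dotZr dot) normrZ exprMn gtr0_norm//.
  by rewrite (dotC dot e).
have F0 := sqr_ge0 `|F|.
have FF := sqr_ge0 `|(r + r ^+ 2 / 2) *: Y - F|.
rewrite (dotDr dot) (dotNr dot) !(dotZr dot) in FG.
move: FG FF F0; rewrite (normB_sqr dotE) (dotZl dot) normrZ exprMn real_normK ?num_real//.
rewrite (dotC dot F Y) (normD_sqr dotE Y) (normD_sqr dotE G) (dotC dot F G).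
move: UW YU; move: (`|W - _| ^+ 2) (`|W| ^+ 2) (dot e _) => p q s.
move: (`|Y| ^+ 2) (`|F| ^+ 2) (`|G| ^+ 2) (`|e| ^+ 2) (dot Y F) (dot G F).
move=> y f g E yf gf pq YU FG FF F0.
have f0 : 0 <= f by exact: F0.
have t0 : 0 < r + r ^+ 2 / 2 by rewrite addr_gt0// divr_gt0// exprn_gt0.
(* Young's inequality with weight [r + r^2 / 2], exactly the surplus over [|Y|^2 / 2] left by the
   factor [(1 + r)^2] in [YU]. *)
have A : 2 * yf <= (r + r ^+ 2 / 2) * y + f / (r + r ^+ 2 / 2).
  rewrite -(ler_pM2l t0) mulrDr [_ * (f / _)]mulrC divfK ?gt_eqF//; nra.
(* Here [r <= 1] gives [4 / 3 - r^2 / 3 >= 1]. The [2 / 3 f] kept aside pays for the terms [f / 2]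
   and [f / 6] of the two expanded squares. *)
have B : f / (r + r ^+ 2 / 2) <= 4 / 3 * (f / r) - 2 / 3 * f.
  rewrite ler_pdivrMr//.
  have -> : (4 / 3 * (f / r) - 2 / 3 * f) * (r + r ^+ 2 / 2) =
      f * (4 / 3 - r ^+ 2 / 3).
    by field; rewrite gt_eqF.
  by rewrite ler_peMr//; nra.
have C : gf <= 3 * yf - 4 * (f / r).
  rewrite -(ler_pM2l r0) mulrBr [r * (4 * _)](_ : _ = 4 * f); last first.
    by field; rewrite gt_eqF.
  lra.
nra.
Qed.
(** Instance of [descent_gram]: the condition on [D] is cocoercivity at [z] and [v], the one on [F]
    is monotonicity at [v'] and [v]. The vector [U] paired with the error is built without [e],
    hence before the noise is drawn. *)
Lemma step_descent (c w r : R) (x n x' n' z v v' e : H) :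
  0 < c -> 0 < w -> 0 < r <= 1 -> c * r * (w * (1 + r / 2)) <= 1 ->
  z = x + (w * (1 + r / 2)) *: n ->
  v + (c * (w * (1 + r / 2))) *: (v - T v) = x ->
  v' + (c * w) *: (v' - T v') = x' ->
  (1 + r) *: n' = n - r *: (c *: (z - T z) - e) ->
  x' = x + (3 / 4 * r * w) *: n' ->
  let g := c *: (v - T v) in
  let U := n + g - r *: (c *: (z - T z) - g) in
  `|U| ^+ 2 <= `|n + g| ^+ 2 /\
  potential n' (c *: (v' - T v')) <=
    potential n g + r * dot e U + r ^+ 2 * `|e| ^+ 2 / 2.
Proof.
move=> c0 w0 r01 crw zE vE v'E n'E x'E g U.
have r0 : 0 < r by case/andP: r01.
set w1 := w * (1 + r / 2) in crw zE vE.
have DE : c *: (z - T z) - g = c *: ((z - T z) - (v - T v)).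
  by rewrite -scalerBr.
have zv : z - v = w1 *: (n + g).
  rewrite zE -[in LHS]vE /g; move: (T v) => s.
  by apply: (dot_inj dotE) => h; rewrite !(dot_lin dot); ring.
have w10 : 0 < w1 by rewrite mulr_gt0//; lra.
(* Since [z - v] is [w1 (n + g)], cocoercivity bounds [|D|^2] by [2 c w1] times [dot D (n + g)], and
   [c r w1 <= 1] does the rest. *)
have DW : r / 2 * `|c *: (z - T z) - g| ^+ 2 <=
    dot (c *: (z - T z) - g) (n + g).
  have := residual_cocoercive dotE neT z v.
  rewrite zv (dotZr dot) DE (dotZl dot) normrZ exprMn gtr0_norm//.
  have := sqr_ge0 `|z - T z - (v - T v)|.
  move: (_ ^+ 2) (dot _ _) => p q p0 pq.
  have q0 : 0 <= q by rewrite -(pmulr_rge0 _ w10); lra.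
  have : c * (r / 2 * c * p) <= c * (r / 2 * c * (2 * (w1 * q))).
    by rewrite ler_pM2l// ler_pM2l// mulr_gt0// divr_gt0.
  have : c * r * w1 * (c * q) <= 1 * (c * q).
    by rewrite ler_wpM2r// mulr_ge0// ltW.
  lra.
split; first exact: norm_step_le.
have gg : c *: (v' - T v') = g + (c *: (v' - T v') - g) by rewrite [RHS]addrC subrK.
rewrite /potential.
have -> : n' + c *: (v' - T v') = (n' + g) + (c *: (v' - T v') - g).
  by rewrite [in LHS]gg addrA.
rewrite {2}gg; apply: descent_gram => //.
  rewrite scalerDr n'E; move: (T z) => s.
  by apply: (dot_inj dotE) => h; rewrite !(dot_lin dot); ring.
have := residual_cocoercive dotE neT v' v.
(* The drop of the resolvent parameter from [w (1 + r / 2)] to [w] contributes [r / 2] to the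
   coefficient of [g]; the step of [x] contributes [- 3 / 4 r]; together they leave [- r / 4]. *)
have -> : v' - v = w *: ((3 / 4 * r) *: (n' + g) - (r / 4) *: g
    - (c *: (v' - T v') - g)).
  have v'd : v' = x' - (c * w) *: (v' - T v') by rewrite -v'E addrK.
  rewrite [X in X - v]v'd x'E -[in LHS]vE -/w1 /g /w1; move: (T v') (T v) => s' s.
  by apply: (dot_inj dotE) => h; rewrite !(dot_lin dot); field.
set F := c *: (v' - T v') - g; set X := (X in dot _ (w *: X)).
have FE : F = c *: (v' - T v' - (v - T v)) by rewrite /F /g -scalerBr.
rewrite (dotZr dot) => FX.
have : 0 <= dot F X.
  rewrite FE (dotZl dot) mulr_ge0// ?(ltW c0)// -(pmulr_rge0 _ w0).
  by have := sqr_ge0 `|v' - T v' - (v - T v)|; lra.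
by rewrite /X (dotDr dot) (dotNr dot) -dotE; lra.
Qed.

Lemma residual_shift (c s : R) (x y : H) : 0 <= c ->
  c * `|x - y| <= s -> c * `|x - T x| <= c * `|y - T y| + 2 * s.
Proof.
move=> c0 xys; have := residual_lipschitz neT x y => xy.
have : `|x - T x| <= `|y - T y| + 2 * `|x - y|.
  rewrite -lerBlDl; apply: le_trans xy; exact: lerB_dist.
by move=> /(ler_wpM2l c0); rewrite mulrDr; lra.
Qed.

(** As [c w <= 1], the distances between [v], [z], [x] and [y], scaled by [c], are at most the norms
    of [n + g] and [n]. The residual bound then travels from [v] to the other points by Lipschitz
    continuity. *)
Lemma final_residual (c w t : R) (x n z v y : H) :
  0 < c -> 0 <= w -> c * w <= 1 -> `|t| <= 1 ->
  z = x + w *: n -> v + (c * w) *: (v - T v) = x -> y = x + t *: (z - x) ->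
  let g := c *: (v - T v) in let p := potential n g in
  [/\ c ^+ 2 * `|x - T x| ^+ 2 <= 900 * p, c ^+ 2 * `|y - T y| ^+ 2 <= 900 * p
    & c ^+ 2 * `|z - T z| ^+ 2 <= 900 * p].
Proof.
move=> c0 w0 cw t1 zE vE yE g p.
have ng0 := sqr_ge0 `|n + g|; have g0 := sqr_ge0 `|g|.
have p0 : 0 <= p by rewrite /p /potential; lra.
set s := Num.sqrt p; have s0 : 0 <= s by exact: sqrtr_ge0.
have ps : p = s ^+ 2 by rewrite sqr_sqrtr.
have ngs : `|n + g| <= 2 * s.
  rewrite -(@ler_pXn2r _ 2) ?nnegrE ?mulr_ge0// exprMn -ps /p /potential; lra.
have gs : `|g| <= 3 * s.
  rewrite -(@ler_pXn2r _ 2) ?nnegrE ?mulr_ge0// exprMn -ps /p /potential; lra.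
have ns : `|n| <= 5 * s.
  have -> : n = (n + g) - g by rewrite addrK.
  by rewrite (le_trans (ler_normB _ _))//; lra.
have shift (u q : H) k : 0 <= k -> u = w *: q -> `|q| <= k -> c * `|u| <= k.
  move=> k0 -> qk; rewrite normrZ ger0_norm// mulrA.
  by rewrite -[leRHS]mul1r ler_pM// mulr_ge0// ltW.
have zv : z - v = w *: (n + g).
  rewrite zE -[in LHS]vE /g; move: (T v) => q.
  by apply: (dot_inj dotE) => h; rewrite !(dot_lin dot); ring.
have xz : x - z = w *: (- n) by rewrite zE opprD addrA subrr add0r scalerN.
have gv : `|g| = c * `|v - T v| by rewrite normrZ gtr0_norm.
(* Constants: [7 = 3 + 2 * 2] from [v] to [z], [17 = 7 + 2 * 5] from [z] to [x], [27 = 17 + 2 * 5]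
   from [x] to [y]. All are below [30], the root of [900]. *)
have Rz : c * `|z - T z| <= 7 * s.
  have := residual_shift (ltW c0) (shift _ _ _ _ zv ngs).
  by rewrite -gv => /(_ (mulr_ge0 (ler0n _ 2) s0)); lra.
have Rxz : c * `|x - z| <= 5 * s.
  by apply: (shift _ (- n)) => //; rewrite ?normrN// mulr_ge0.
have Rx : c * `|x - T x| <= 17 * s.
  by have := residual_shift (ltW c0) Rxz; lra.
have Ry : c * `|y - T y| <= 27 * s.
  have yx : c * `|y - x| <= 5 * s.
    rewrite yE addrC addKr normrZ distrC; apply: le_trans Rxz.
    by rewrite ler_pM2l// ler_piMl.
  by have := residual_shift (ltW c0) yx; lra.
have conc k (a : H) : 0 <= k <= 30 -> c * `|a| <= k * s -> c ^+ 2 * `|a| ^+ 2 <= 900 * p.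
  move=> /andP[k0 k30] H1; rewrite ps -exprMn.
  have -> : 900 * s ^+ 2 = (30 * s) ^+ 2 by ring.
  rewrite ler_pXn2r ?nnegrE ?mulr_ge0 ?(ltW c0)//.
  by apply: le_trans H1 _; rewrite ler_wpM2r.
by split; [apply: (conc 17)|apply: (conc 27)|apply: (conc 7)] => //;
  apply/andP; split; lra.
Qed.

(** Because [p] has zero residual, [v - T v] has nonnegative product with [v - p]; Cauchy-Schwarz
    then gives [c w |v - T v| <= |x - p|]. With zero momentum the potential is [2 / 3 |g|^2]. *)
Lemma potential_init (c w : R) (x v p : H) : 0 < c -> 0 < w -> T p = p ->
  v + (c * w) *: (v - T v) = x ->
  potential 0 (c *: (v - T v)) <= (`|x - p| / w) ^+ 2.
Proof.
move=> c0 w0 Tp vE; rewrite /potential add0r.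
suff h : w * `|c *: (v - T v)| <= `|x - p|.
  have : `|c *: (v - T v)| <= `|x - p| / w by rewrite ler_pdivlMr// mulrC.
  rewrite -(@ler_pXn2r _ 2) ?nnegrE ?divr_ge0//; last exact: ltW.
  by have := sqr_ge0 `|c *: (v - T v)|; lra.
have := residual_cocoercive dotE neT v p; rewrite Tp subrr subr0.
have -> : v - p = (x - p) - (c * w) *: (v - T v) by rewrite -vE addrAC addrK.
rewrite (dotDr dot) (dotNr dot) (dotZr dot) -dotE => h.
have {h} : (c * w) * `|v - T v| ^+ 2 <= `|v - T v| * `|x - p|.
  have := dot_le_norm dotE (v - T v) (x - p); have := ler_norm (dot (v - T v) (x - p)).
  have := sqr_ge0 `|v - T v|; lra.
rewrite normrZ gtr0_norm//; have [->|v0] := eqVneq (v - T v) 0.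
  by rewrite normr0 !mulr0.
by rewrite expr2 mulrA (mulrC _ `|v - T v|) ler_pM2l ?normr_gt0//; lra.
Qed.
End descent.

(** * The softplus schedule *)

Section schedule.
Context (R : realType) (a : R) (K : nat).
Hypotheses (a_gt0 : 0 < a) (K_ge2 : (2 <= K)%N).

(** The amount by which [ln (e k)] drops at each step (see [eS]); it measures how fast the schedule
    moves. *)
Let delta := (a + 1) * ln K%:R / K%:R : R.
Hypothesis delta_le : delta <= 1 / 3.

Local Notation w := (sp_omega a K).
Local Notation r := (sp_r a K).
Local Notation u := (sp_u a K).

Definition sp_scale : R := K%:R / (4 * (1 + 1 / a) * w 0%N).

Let KR : 2 <= K%:R :> R. Proof. by rewrite ler_nat. Qed.
Let K0 : 0 < K%:R :> R. Proof. by apply: lt_le_trans KR. Qed.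
Let lnK0 : 0 < ln K%:R :> R.
Proof. by rewrite ln_gt0//; apply: lt_le_trans KR; rewrite ltr1n. Qed.
Let delta0 : 0 < delta.
Proof. by rewrite divr_gt0// mulr_gt0//; have := a_gt0; lra. Qed.

Let e k : R := K%:R `^ (a - (a + 1) * k%:R / K%:R).
Let th : R := expR delta.

Let e0 k : 0 < e k. Proof. by rewrite powR_gt0. Qed.

Let eS k : e k = th * e k.+1.
Proof.
rewrite /e /th -(lnK (x := _ `^ _)) ?posrE ?powR_gt0//.
rewrite -[in RHS](lnK (x := _ `^ _)) ?posrE ?powR_gt0// !ln_powR -expRD.
congr expR; rewrite /delta -[in RHS]natr1; field; exact: lt0r_neq0.
Qed.

Let th1 : 1 < th. Proof. by rewrite expR_gt1. Qed.

(** From [1 - delta <= expR (- delta)], hence [th <= 1 / (1 - delta)], together with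
    [delta <= 1 / 3]. *)
Let th_le : th <= 1 + 3 / 2 * delta.
Proof.
have := expR_ge1Dx (- delta); rewrite expRN -/th => h.
have : th * (1 - delta) <= 1.
  by have := ler_wpM2l (expR_ge0 delta) h; rewrite mulfV ?gt_eqF ?expR_gt0.
by have := delta0; have := delta_le; have := th1; nra.
Qed.

Lemma sp_omega_gt0 k : 0 < w k.
Proof. by rewrite /sp_omega ln_gt0// ltrDl powR_gt0. Qed.

Let w_ge k : e k / (1 + e k) <= w k.
Proof.
have e1 : 0 < 1 + e k by have := e0 k; lra.
have -> : w k = - ln (1 + e k)^-1 by rewrite lnV ?posrE// opprK.
rewrite [X in ln X](_ : _ = 1 + - (e k / (1 + e k))); last first.
  by field; rewrite gt_eqF.
rewrite lerNr le_ln1Dx// ltrN2 ltr_pdivrMr//; lra.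
Qed.

Let wB k : w k - w k.+1 = ln ((1 + th * e k.+1) / (1 + e k.+1)).
Proof.
rewrite /sp_omega -/(e k) -/(e k.+1) eS ln_div// posrE.
  by have := e0 k.+1; have := th1; nra.
by have := e0 k.+1; lra.
Qed.

Let wB_gt0 k : 0 < w k - w k.+1.
Proof.
rewrite wB ln_gt0// ltr_pdivlMr; have := e0 k.+1; last lra.
by have := th1; nra.
Qed.

Let wB_delta k : w k - w k.+1 <= delta.
Proof.
rewrite wB -[leRHS](expRK delta) -/th ler_ln ?posrE.
- rewrite ler_pdivrMr; have := e0 k.+1; last lra.
  by have := th1; nra.
- by rewrite divr_gt0//; have := e0 k.+1; have := th1; nra.
- exact: expR_gt0.
Qed.

(** The inequality [ln (1 + t) <= t] followed by [w_ge]. This relative bound controls [r_k], whereas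
    the absolute bound [wB_delta] controls the step size. *)
Let wB_le k : w k - w k.+1 <= (th - 1) * w k.+1.
Proof.
have e1 : 0 < 1 + e k.+1 by have := e0 k.+1; lra.
rewrite (@le_trans _ _ ((th - 1) * (e k.+1 / (1 + e k.+1))))//; last first.
  by rewrite ler_wpM2l ?w_ge// subr_ge0 ltW.
rewrite wB (_ : _ / _ = 1 + (th - 1) * (e k.+1 / (1 + e k.+1))); last first.
  by field; rewrite gt_eqF.
rewrite le_ln1Dx// (lt_trans (ltrN10 _))// mulr_gt0 ?subr_gt0//.
by rewrite divr_gt0.
Qed.

Lemma sp_omega_pred k : w k = w k.+1 * (1 + r k.+1 / 2).
Proof. by rewrite /sp_r /=; field; rewrite gt_eqF// sp_omega_gt0. Qed.

Lemma sp_r_gt0 k : 0 < r k.+1.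
Proof.
have := wB_gt0 k; rewrite subr_gt0 /sp_r /= => h.
by rewrite mulr_gt0// subr_gt0 ltr_pdivlMr ?sp_omega_gt0// mul1r.
Qed.

Lemma sp_r_le k : r k.+1 <= 3 * delta.
Proof.
rewrite /sp_r /=; have := wB_le k; have w0 := sp_omega_gt0 k.+1.
rewrite lerBlDr -[X in _ + X]mul1r -mulrDl subrK -ler_pdivrMr// => h.
by have := th_le; lra.
Qed.

Lemma sp_r_le1 k : r k.+1 <= 1.
Proof. by apply: le_trans (sp_r_le k) _; have := delta_le; lra. Qed.

Let scale_den : 0 < 4 * (1 + 1 / a).
Proof. by rewrite mulr_gt0// addr_gt0// divr_gt0. Qed.

Lemma sp_scale_gt0 : 0 < sp_scale.
Proof. by rewrite divr_gt0// mulr_gt0 ?sp_omega_gt0. Qed.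

Lemma sp_scale_omega0 : sp_scale * w 0%N = K%:R / (4 * (1 + 1 / a)).
Proof.
have /lt0r_neq0 w0 := sp_omega_gt0 0; have a1 : a + 1 != 0.
  by rewrite gt_eqF// ltr_wpDr.
by rewrite /sp_scale; field; rewrite a1 w0 gt_eqF.
Qed.

Let w0_ge : a * ln K%:R <= w 0%N.
Proof.
rewrite /sp_omega mulr0 mul0r subr0 -ln_powR.
by rewrite ler_ln ?posrE ?addr_gt0 ?powR_gt0// lerDr.
Qed.

(** The factor [1 + 1 / a] of the schedule is calibrated for this:
    [(a + 1) ln K = (1 + 1 / a) (a ln K)], and [a ln K <= omega_0]. *)
Let scale_delta : sp_scale * delta <= 1 / 4.
Proof.
rewrite /sp_scale mulrC mulrA ler_pdivrMr; last first.
  exact: mulr_gt0 scale_den (sp_omega_gt0 0).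
rewrite /delta divfK ?gt_eqF//.
have -> : 1 / 4 * (4 * (1 + 1 / a) * w 0%N) = (a + 1) * (w 0%N / a).
  by field; rewrite gt_eqF.
rewrite ler_wpM2l//; first by have := a_gt0; lra.
by rewrite ler_pdivlMr// (mulrC _ a); exact: w0_ge.
Qed.

(** The step-size condition of [step_descent]. The product is [2 c (w k - w k.+1) (1 + r / 2)], at
    most [2 * 1/4 * 3/2]. *)
Lemma sp_step_le1 k : sp_scale * r k.+1 * w k <= 1.
Proof.
have rw : r k.+1 * w k = 2 * ((w k - w k.+1) * (1 + r k.+1 / 2)).
  by rewrite /sp_r /=; field; rewrite gt_eqF// sp_omega_gt0.
rewrite -mulrA rw.
have h : sp_scale * (w k - w k.+1) <= 1 / 4.
  by apply: le_trans scale_delta; rewrite ler_pM2l ?sp_scale_gt0.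
have := sp_r_le1 k; have := sp_r_gt0 k.
have : 0 < sp_scale * (w k - w k.+1) by rewrite mulr_gt0 ?sp_scale_gt0.
rewrite [X in _ -> _ -> _ -> X <= _](_ : _ =
  2 * (sp_scale * (w k - w k.+1) * (1 + r k.+1 / 2))); last by ring.
by move: h; move: (sp_scale * _) (r _) => p q; nra.
Qed.

Lemma sp_scale_last : sp_scale * w K.-1 <= 1.
Proof.
(* The exponent reaches [-1] at [k = K], so one step earlier [e] is [th / K], and [omega_(K-1)] is
   of order [1 / K]. *)
have eK : e K.-1 = th * K%:R^-1.
  rewrite eS prednK ?(ltn_trans _ K_ge2)//; congr (_ * _).
  rewrite /e mulfK ?gt_eqF// opprD addrA subrr add0r powR_inv1//; exact: ltW.
have wK : w K.-1 <= 2 / K%:R.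
  rewrite /sp_omega -/(e K.-1) (le_trans (le_ln1Dx _))//.
    by apply: lt_trans (e0 _); rewrite ltrN10.
  rewrite eK ler_pM2r ?invr_gt0//; have := th_le; have := delta_le; lra.
have w01 : 1 / 2 <= w 0%N.
  have ea : 1 <= e 0%N.
    rewrite /e mulr0 mul0r subr0 -[leLHS](powRr0 (K%:R : R)).
    by apply: ler_powR; [rewrite ler1n (leq_trans _ K_ge2)|exact: ltW].
  apply: le_trans (w_ge _).
  by rewrite ler_pdivlMr; have := ea; lra.
have : sp_scale * w K.-1 <= sp_scale * (2 / K%:R).
  by rewrite ler_pM2l ?sp_scale_gt0.
move=> /le_trans -> //.
rewrite /sp_scale [leLHS](_ : _ = 2 / (4 * (1 + 1 / a) * w 0%N)); last first.
  have /lt0r_neq0 w0 := sp_omega_gt0 0; have a1 : a + 1 != 0.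
    by rewrite gt_eqF// ltr_wpDr.
  by field; rewrite a1 w0 !gt_eqF.
rewrite ler_pdivrMr; last exact: mulr_gt0 scale_den (sp_omega_gt0 0).
rewrite [leRHS]mul1r.
by have : 0 < 1 / a; [rewrite divr_gt0|nra].
Qed.

Lemma sp_u_bounds k : 0 < u k.+1 <= 1 / 2.
Proof.
have r0 := sp_r_gt0 k; have d0 : 0 < 2 * (1 + r k.+1) * (2 + r k.+1) by nra.
rewrite /sp_u divr_gt0//=; last by lra.
by rewrite ler_pdivrMr//; nra.
Qed.

Lemma sp_lambdaE k : sp_lambda a K k.+1 = sp_scale * r k.+1 * w k * u k.+1.
Proof.
rewrite /sp_lambda /sp_scale /=; field.
by rewrite !gt_eqF ?sp_omega_gt0 //; have := a_gt0; lra.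
Qed.

Lemma sp_lambda_bounds k : 0 < sp_lambda a K k.+1 <= 1 / 2.
Proof.
rewrite sp_lambdaE; have /andP[u0 u1] := sp_u_bounds k.
have := sp_step_le1 k.
have : 0 < sp_scale * r k.+1 * w k.
  apply: mulr_gt0 (sp_omega_gt0 k); exact: mulr_gt0 sp_scale_gt0 (sp_r_gt0 k).
by move=> h1 h2; rewrite mulr_gt0//=; nra.
Qed.

End schedule.

(** * Comparison of the logarithm with the square root *)

Section deterministic_bounds.
Context (R : realType).

(* The two regimes are [K <= X ^ 6] and [K > X ^ 6]. *)
Lemma ln_div_sqrt_le (M X k : R) : 1 <= M -> 6 * M <= X -> 0 < k ->
  (6 * M) ^+ 2 * (X ^+ 2 * ln X ^+ 2) <= k -> M * X * ln k <= Num.sqrt k.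
Proof.
move=> M1 MX k0 hk.
have X0 : 1 < X by lra.
have lX : 0 < ln X by exact: ln_gt0.
have [lk|lk] := leP (ln k) (6 * ln X).
  have : 6 * M * (X * ln X) <= Num.sqrt k.
    rewrite -(@ler_pXn2r _ 2) ?nnegrE ?sqrtr_ge0//; last first.
      by rewrite !mulr_ge0//; lra.
    rewrite sqr_sqrtr ?(ltW k0)//; apply: le_trans hk.
    by rewrite !exprMn le_eqVlt -mulrA eqxx.
  apply: le_trans.
  have -> : 6 * M * (X * ln X) = M * X * (6 * ln X) by ring.
  by rewrite ler_pM2l// mulr_gt0//; lra.
(* The sixth root of [k]: now [6 M <= X <= y] and [ln k = 6 ln y <= 6 y], while [sqrt k] is
   [y^3]. *)
set y := expR (ln k / 6).
have kE : k = y ^+ 6.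
  rewrite -(lnK (x := k)) ?posrE// -expRM_natl; congr expR.
  by field.
have y0 : 0 < y by exact: expR_gt0.
have Xy : X <= y.
  rewrite -(lnK (x := X)) ?posrE; last lra.
  by rewrite ler_expR; lra.
have -> : Num.sqrt k = y ^+ 3.
  rewrite kE; have -> : y ^+ 6 = (y ^+ 3) ^+ 2 by rewrite -exprM.
  by rewrite sqrtr_sqr ger0_norm// exprn_ge0// ltW.
have -> : ln k = 6 * ln y by rewrite kE lnXn// mulr_natl.
have ly : ln y <= y by exact/ltW/ln_sublinear.
apply: (@le_trans _ _ (M * X * (6 * y))).
  by rewrite ler_pM2l ?mulr_gt0//; lra.
have -> : M * X * (6 * y) = 6 * M * X * y by ring.
have -> : y ^+ 3 = y * y * y by ring.
by rewrite ler_pM2r// ler_pM//; lra.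
Qed.

Lemma ln_le_sqrt (k : R) : 0 < k -> ln k <= 2 * Num.sqrt k.
Proof.
move=> k0; have -> : ln k = 2 * ln (Num.sqrt k).
  by rewrite -{1}(sqr_sqrtr (ltW k0)) lnXn ?sqrtr_gt0// mulr_natl.
by rewrite ler_pM2l//; apply/ltW/ln_sublinear; rewrite sqrtr_gt0.
Qed.

End deterministic_bounds.

(** * Strong measurability and conditional expectation *)

Section strong_measurability.
Context (d : measure_display) (Omega : measurableType d) (R : realType).
Context (G : set (set Omega)).
Hypothesis sG : sigma_algebra setT G.

(** Both maps take finitely many values, so for an arbitrary relation [Q] the event is a finite
    union of intersections of fibres. *)
Lemma simple_rv_preimage (H1 H2 : normedModType R) (s : Omega -> H1)
    (t : Omega -> H2) (Q : H1 -> H2 -> Prop) :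
  simple_rv G s -> simple_rv G t -> G [set w | Q (s w) (t w)].
Proof.
move=> [fs ms] [ft mt].
have -> : [set w | Q (s w) (t w)] = \bigcup_(u in range s)
    \bigcup_(v in range t `&` Q u) (s @^-1` [set u] `&` t @^-1` [set v]).
  apply/seteqP; split=> w /=.
    move=> Qw; exists (s w); first by exists w.
    by exists (t w) => //; split=> //; exists w.
  by case=> u _ [v [_ Quv] [su tv]]; rewrite su tv.
rewrite -(sigma_algebra_id sG).
apply: (@fin_bigcup_measurable _ (g_sigma_algebraType G)) => // u _.
apply: (@fin_bigcup_measurable _ (g_sigma_algebraType G)) => [|v _].
  exact: finite_setIl.
by apply: (@measurableI _ (g_sigma_algebraType G)); apply: sub_gen_smallest.
Qed.

Lemma simple_rv_comp (H1 H2 H3 : normedModType R) (f : H1 -> H2 -> H3) s t :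
  simple_rv G s -> simple_rv G t -> simple_rv G (fun w : Omega => f (s w) (t w)).
Proof.
move=> ss st; split=> [|h]; last exact: (simple_rv_preimage (fun u v => f u v = h)).
apply: sub_finite_set (finite_image2 f ss.1 st.1) => _ [w _ <-] /=.
by exists (s w); [exists w|exists (t w); [exists w|]].
Qed.

(** Sequential continuity passes to the limit of simple approximations. Unary maps are the case
    where [f] ignores its second argument. *)
Lemma strongly_measurable_comp (H1 H2 H3 : normedModType R)
    (f : H1 -> H2 -> H3) (X : Omega -> H1) (Y : Omega -> H2) :
  (forall (u_ : nat -> H1) (v_ : nat -> H2) u v,
    u_ n @[n --> \oo] --> u -> v_ n @[n --> \oo] --> v ->
    f (u_ n) (v_ n) @[n --> \oo] --> f u v) ->
  strongly_measurable G X -> strongly_measurable G Y ->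
  strongly_measurable G (fun w => f (X w) (Y w)).
Proof.
move=> cf [s [ss sX]] [t [st tY]]; exists (fun n w => f (s n w) (t n w)).
by split=> [n|w]; [exact: simple_rv_comp|exact: cf].
Qed.

Lemma strongly_measurable_cst (H : normedModType R) (h : H) :
  strongly_measurable G (fun=> h).
Proof.
exists (fun _ _ => h); split=> [n|w]; last exact: cvg_cst.
split=> [|k].
  by apply: sub_finite_set (finite_set1 h) => _ [w _ <-].
rewrite -(sigma_algebra_id sG).
have [->|hk] := EM (h = k).
  rewrite (_ : _ @^-1` _ = setT); first exact: (@measurableT _ (g_sigma_algebraType G)).
  by apply/seteqP; split.
rewrite (_ : _ @^-1` _ = set0); first exact: (@measurable0 _ (g_sigma_algebraType G)).
by apply/seteqP; split.
Qed.

Section closure.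
Context (H : normedModType R).
Implicit Types X Y : Omega -> H.

Lemma strongly_measurableD X Y : strongly_measurable G X ->
  strongly_measurable G Y -> strongly_measurable G (fun w => X w + Y w).
Proof. by apply: strongly_measurable_comp => u_ v_ u v; exact: cvgD. Qed.

Lemma strongly_measurableB X Y : strongly_measurable G X ->
  strongly_measurable G Y -> strongly_measurable G (fun w => X w - Y w).
Proof.
by apply: (strongly_measurable_comp (f := fun u v => u - v)) => u_ v_ u v; exact: cvgB.
Qed.

Lemma strongly_measurableZ (k : R) X : strongly_measurable G X ->
  strongly_measurable G (fun w => k *: X w).
Proof.
move=> mX; apply: (strongly_measurable_comp (f := fun u _ : H => k *: u) (Y := X)) => //.
by move=> u_ v_ u v ? _; apply: cvgZ => //; exact: cvg_cst.
Qed.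

Lemma cvg_lipschitz (k : R) (f : H -> H) (u_ : nat -> H) u :
  (forall x y, `|f x - f y| <= k * `|x - y|) ->
  u_ n @[n --> \oo] --> u -> f (u_ n) @[n --> \oo] --> f u.
Proof.
move=> fk uu; apply/cvgrPdist_lt => e e0.
have k1 : 0 < `|k| + 1 by rewrite ltr_pwDr.
have /cvgrPdist_lt /(_ (e / (`|k| + 1))) := uu.
rewrite divr_gt0// => /(_ isT); apply: filterS => n un.
apply: le_lt_trans (fk _ _) _.
apply: (@le_lt_trans _ _ ((`|k| + 1) * `|u - u_ n|)).
  by rewrite ler_wpM2r// (le_trans (ler_norm k))// lerDl.
by rewrite mulrC -ltr_pdivlMr.
Qed.

Lemma strongly_measurable_lipschitz (k : R) (f : H -> H) X :
  (forall x y, `|f x - f y| <= k * `|x - y|) ->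
  strongly_measurable G X -> strongly_measurable G (fun w => f (X w)).
Proof.
move=> fk mX; apply: (strongly_measurable_comp (f := fun u _ : H => f u) (Y := X)) => //.
by move=> u_ v_ u v uu _; exact: cvg_lipschitz uu.
Qed.

End closure.
End strong_measurability.

Section real_functions.
Context (d : measure_display) (Omega : measurableType d) (R : realType).

Lemma sub_strongly_measurable (H : normedModType R) (G F : set (set Omega))
    (X : Omega -> H) :
  G `<=` F -> strongly_measurable G X -> strongly_measurable F X.
Proof.
move=> GF [s [ss sX]]; exists s; split=> // n; split=> [|h]; first exact: (ss n).1.
by apply: GF; exact: (ss n).2.
Qed.

(** The bridge from strong to Borel measurability: a real function of simple maps has measurable
    preimages, and pointwise limits preserve this. *)
Lemma measurable_fun_comp (H1 H2 : normedModType R) (f : H1 -> H2 -> R)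
    (X : Omega -> H1) (Y : Omega -> H2) :
  (forall (u_ : nat -> H1) (v_ : nat -> H2) u v,
    u_ n @[n --> \oo] --> u -> v_ n @[n --> \oo] --> v ->
    f (u_ n) (v_ n) @[n --> \oo] --> f u v) ->
  strongly_measurable measurable X -> strongly_measurable measurable Y ->
  measurable_fun setT (fun w => f (X w) (Y w)).
Proof.
move=> cf [s [ss sX]] [t [st tY]].
apply: (@measurable_fun_cvg _ _ _ _ (fun n w => f (s n w) (t n w))).
  move=> n _ B mB; rewrite setTI.
  exact: (simple_rv_preimage (sigma_algebra_measurable _) (fun u v => B (f u v))).
by move=> w _; exact: cf.
Qed.

Lemma measurable_fun_norm_sqr (H : normedModType R) (X : Omega -> H) :
  strongly_measurable measurable X -> measurable_fun setT (fun w => `|X w| ^+ 2).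
Proof.
move=> mX; apply: (measurable_fun_comp (f := fun u _ : H => `|u| ^+ 2) (Y := X)) => //.
by move=> u_ v_ u v uu _; apply: cvgM; exact: cvg_norm.
Qed.

Lemma measurable_fun_norm_rv (H : normedModType R) (X : Omega -> H) :
  strongly_measurable measurable X -> measurable_fun setT (fun w => `|X w|).
Proof.
move=> mX; apply: (measurable_fun_comp (f := fun u _ : H => `|u|) (Y := X)) => //.
by move=> u_ v_ u v uu _; exact: cvg_norm.
Qed.

End real_functions.

(** * Orthogonality of centred noise to the past *)

Section orthogonality.
Context (d : measure_display) (Omega : measurableType d) (R : realType)
  (H : normedModType R) (dot : {dot H for @idfun R}) (P : probability Omega R).
Hypothesis dotE : forall h : H, `|h| ^+ 2 = dot h h.
Local Notation integrable_rv f := (P.-integrable setT (EFin \o f)).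

Lemma le_integrable_rv (f g : Omega -> R) : measurable_fun setT f ->
  (forall w, `|f w| <= g w) -> integrable_rv g -> integrable_rv f.
Proof.
move=> mf fg; apply: le_integrable => //; first exact/measurable_EFinP.
by move=> w _ /=; rewrite lee_fin (le_trans (fg w))// ler_norm.
Qed.

Lemma integrable_rv_cst (k : R) : integrable_rv (fun=> k).
Proof. exact: finite_measure_integrable_cst. Qed.

Lemma integrable_rvD (f g : Omega -> R) : integrable_rv f -> integrable_rv g ->
  integrable_rv (fun w => f w + g w).
Proof. by move=> hf hg; exact: (integrableD _ hf hg). Qed.

Lemma integrable_rvZ (k : R) (f : Omega -> R) : integrable_rv f ->
  integrable_rv (fun w => k * f w).
Proof. by move=> hf; exact: (integrableZl _ k hf). Qed.

(** Polarization expresses [dot] through norms, whose continuity is known. *)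
Lemma cvg_dot (u_ v_ : nat -> H) u v :
  u_ n @[n --> \oo] --> u -> v_ n @[n --> \oo] --> v ->
  dot (u_ n) (v_ n) @[n --> \oo] --> dot u v.
Proof.
move=> uu vv.
have polar x y : dot x y = (`|x + y| * `|x + y| - `|x| * `|x| - `|y| * `|y|) / 2.
  by rewrite -!expr2 (normD_sqr dotE); field.
under eq_fun do rewrite polar.
rewrite polar; apply: cvgM; last exact: cvg_cst.
apply: cvgB; last by apply: cvgM; exact: cvg_norm.
by apply: cvgB; apply: cvgM; apply: cvg_norm => //; exact: cvgD.
Qed.

Lemma measurable_fun_dot (X Y : Omega -> H) :
  strongly_measurable measurable X -> strongly_measurable measurable Y ->
  measurable_fun setT (fun w => dot (X w) (Y w)).
Proof. by apply: measurable_fun_comp => u_ v_ u v; exact: cvg_dot. Qed.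

Lemma integrable_norm_rv (X : Omega -> H) : strongly_measurable measurable X ->
  integrable_rv (fun w => `|X w| ^+ 2) -> integrable_rv (fun w => `|X w|).
Proof.
move=> mX iX; have := integrable_rvD (integrable_rv_cst 1) iX.
apply: le_integrable_rv; first exact: measurable_fun_norm_rv.
by move=> w; rewrite normr_id; have := sqr_ge0 (`|X w| - 1); nra.
Qed.

Lemma integrable_dot (X Y : Omega -> H) :
  strongly_measurable measurable X -> strongly_measurable measurable Y ->
  integrable_rv (fun w => `|X w| ^+ 2) -> integrable_rv (fun w => `|Y w| ^+ 2) ->
  integrable_rv (fun w => dot (X w) (Y w)).
Proof.
move=> mX mY iX iY; have := integrable_rvD iX iY.
apply: le_integrable_rv; first exact: measurable_fun_dot.
move=> w; apply: le_trans (dot_le_norm dotE _ _) _.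
by have := sqr_ge0 (`|X w| - `|Y w|); have := normr_ge0 (X w);
   have := normr_ge0 (Y w); nra.
Qed.

Lemma dominated_integral0 (f_ : nat -> Omega -> R) (f g : Omega -> R) :
  (forall n, measurable_fun setT (f_ n)) ->
  (forall w, f_ n w @[n --> \oo] --> f w) -> integrable_rv g ->
  (forall n w, `|f_ n w| <= g w) -> (forall n, \int[P]_w (f_ n w)%:E = 0)%E ->
  (\int[P]_w (f w)%:E = 0)%E.
Proof.
move=> mf ff ig fg f0.
have : (\int[P]_w (f_ n w)%:E @[n --> \oo] --> \int[P]_w (f w)%:E)%E.
  apply: (@dominated_cvg _ _ _ _ _ _ _ _ (EFin \o g)) => //.
  - by move=> n; exact/measurable_EFinP.
  - by move=> w _; apply: cvg_EFin; [exact: nearW|exact: ff].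
  - by move=> n w _ /=; rewrite lee_fin.
by under eq_fun do rewrite f0; move=> /cvg_lim <-//; rewrite lim_cst.
Qed.

Lemma sum_range_simple (s : Omega -> H) (f : H -> Omega -> R) w :
  finite_set (range s) ->
  (\sum_(u <- fset_set (range s)) ((EFin \o f u) \_ (s @^-1` [set u])) w)%E =
  (f (s w) w)%:E.
Proof.
move=> fs; rewrite (bigD1_seq (s w)) ?fset_uniq//=; last first.
  by rewrite in_fset_set//; apply/mem_set; exists w.
rewrite patchE mem_set//= big1 ?adde0// => u us.
by rewrite patchE memNset// => /= su; move: us; rewrite su eqxx.
Qed.

(** The first argument of [f] is constant on each fibre of [s]; the second one lets a random vector
    such as [X w] be carried along. *)
Lemma integral_simple (s : Omega -> H) (f : H -> Omega -> R) A :
  measurable A -> simple_rv measurable s ->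
  (forall u, P.-integrable A (EFin \o f u)) ->
  (\int[P]_(w in A) (f (s w) w)%:E =
   \sum_(u <- fset_set (range s)) \int[P]_(w in A `&` s @^-1` [set u]) (f u w)%:E)%E.
Proof.
move=> mA [fs ms] fi; under eq_integral => w _ do rewrite -(sum_range_simple f w fs).
rewrite integral_sum//; last first.
  move=> u; apply/integrable_restrict => //.
  by apply: integrableS (fi u) => //; exact: measurableI.
apply: eq_bigr => u _; by rewrite integral_mkcondr.
Qed.

Lemma simple_dot_integral (s : Omega -> H) A h : measurable A ->
  simple_rv measurable s ->
  (\int[P]_(w in A) (dot h (s w))%:E = (dot h (simple_integral P A s))%:E)%E.
Proof.
move=> mA ss; rewrite (integral_simple (f := fun u _ => dot h u))//; last first.
  by move=> u; exact: finite_measure_integrable_cst.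
rewrite /simple_integral fsbig_finite/=; last exact: ss.1.
rewrite linear_sum -sumEFin; apply: eq_bigr => u _.
rewrite integral_cst; last by apply: measurableI => //; exact: ss.2.
rewrite linearZ/= mulrC EFinM fineK//; apply: fin_num_measure.
by apply: measurableI => //; exact: ss.2.
Qed.

(** Pairing with [h] commutes with the integral of each simple [s n], and the error is at most [|h|]
    times the integral of [|X - s n|], which tends to zero. *)
Lemma bochner_dot (A : set Omega) (X : Omega -> H) (v h : H) : measurable A ->
  P.-integrable A (EFin \o (fun w => dot h (X w))) ->
  is_bochner_integral P A X v ->
  (\int[P]_(w in A) (dot h (X w))%:E = (dot h v)%:E)%E.
Proof.
move=> mA iX [mX [s [ss sX sv]]].
have smeas n : strongly_measurable measurable (s n).
  by exists (fun _ => s n); split=> // w; exact: cvg_cst.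
have mA' (f : Omega -> R) : measurable_fun setT f -> measurable_fun A f.
  by move=> mf; apply: measurable_funS mf.
have is_ n : P.-integrable A (EFin \o (fun w => dot h (s n w))).
  have [M hM] : exists M, forall w, `|dot h (s n w)| <= M.
    have fs : finite_set [set `|dot h (s n w)| | w in setT].
      rewrite (_ : [set _ | _ in _] = (fun u => `|dot h u|) @` range (s n)).
        by apply: finite_image; exact: (ss n).1.
      by rewrite image_comp.
    (* The values are finitely many and nonnegative, so their sum dominates each of them. *)
    exists (\sum_(x <- fset_set [set `|dot h (s n w)| | w in setT]) x) => w.
    rewrite (bigD1_seq `|dot h (s n w)|) ?fset_uniq//=; last first.
      by rewrite in_fset_set//; apply/mem_set; exists w.
    rewrite lerDl big_seq_cond sumr_ge0// => x /andP[].
    by rewrite in_fset_set// => /set_mem[w' _ <-].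
  apply: (@le_integrable _ _ _ _ _ _ _ (EFin \o cst M)) => //.
  - by apply/measurable_EFinP/mA'/measurable_fun_dot => //;
    apply: strongly_measurable_cst; exact: sigma_algebra_measurable.
  - by move=> w _ /=; rewrite lee_fin (le_trans (hM w))// ler_norm.
  - exact: finite_measure_integrable_cst.
set I := fine (\int[P]_(w in A) (dot h (X w))%:E)%E.
have IE : (\int[P]_(w in A) (dot h (X w))%:E)%E = I%:E.
  by rewrite fineK//; exact: integrable_fin_num.
have bound n : (`|dot h (simple_integral P A (s n)) - I|%:E <=
    `|h|%:E * \int[P]_(w in A) `|X w - s n w|%:E)%E.
  have -> : `|dot h (simple_integral P A (s n)) - I|%:E =
      (`| \int[P]_(w in A) ((dot h (s n w))%:E - (dot h (X w))%:E) |)%E.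
    rewrite integralB//; last exact: (is_ n).
    by rewrite simple_dot_integral// IE -EFinB.
  have md : measurable_fun setT (fun w => `|X w - s n w|).
    apply: measurable_fun_norm_rv; apply: strongly_measurableB => //.
    exact: sigma_algebra_measurable.
  have mdot : measurable_fun A (fun w => dot h (s n w) - dot h (X w)).
    apply: mA'; apply: measurable_funB; apply: measurable_fun_dot => //;
    by apply: strongly_measurable_cst; exact: sigma_algebra_measurable.
  apply: le_trans (le_abse_integral _ _ _) _ => //.
    exact/measurable_EFinP.
  rewrite -ge0_integralZl//; last exact/measurable_EFinP/mA'.
  apply: ge0_le_integral => //.
  - by apply: measurableT_comp => //; exact/measurable_EFinP.
  - apply: measurable_funeM; exact/measurable_EFinP/mA'.
  - move=> w _; rewrite -EFinB abse_EFin -EFinM lee_fin -(linearB (dot h)).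
    by rewrite distrC; exact: dot_le_norm.
have lim0 : (`|dot h (simple_integral P A (s n)) - I|%:E @[n --> \oo] --> 0)%E.
  have h0 : (`|h|%:E * \int[P]_(w in A) `|X w - s n w|%:E @[n --> \oo] --> 0)%E.
    have /cvgeZl : `|h|%:E \is a fin_num by [].
    by move=> /(_ _ _ _ _ sX); rewrite mule0.
  apply: (squeeze_cvge _ (cvg_cst 0%E) h0).
  by apply: nearW => n; rewrite lee_fin normr_ge0/= bound.
rewrite IE; congr (_%:E).
have l1 : `|dot h (simple_integral P A (s n)) - I| @[n --> \oo] --> `|dot h v - I|.
  apply: cvg_norm; apply: cvgB; last exact: cvg_cst.
  by apply: cvg_dot => //; exact: cvg_cst.
have l2 : `|dot h (simple_integral P A (s n)) - I| @[n --> \oo] --> (0 : R).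
  by have /fine_cvgP[_] := lim0.
have /eqP : `|dot h v - I| = 0.
  by rewrite -(cvg_lim _ l1)//; exact: cvg_lim l2.
by rewrite normr_eq0 subr_eq0 => /eqP ->.
Qed.

Section conditional.
Context (F : set (set Omega)).
Hypotheses (sF : sigma_algebra setT F) (Fm : F `<=` measurable).

Section zero_mean.
Context (X : Omega -> H).
Hypotheses (mX : strongly_measurable measurable X)
  (iX : integrable_rv (fun w => `|X w| ^+ 2)) (X0 : is_cond_exp P F X (fun=> 0)).

Let intX h A : measurable A -> P.-integrable A (EFin \o (fun w => dot h (X w))).
Proof.
move=> mA; apply: (@integrableS _ _ _ P setT) => //.
apply: integrable_dot => //; last exact: integrable_rv_cst.
by apply: strongly_measurable_cst; exact: sigma_algebra_measurable.
Qed.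

(** [is_cond_exp] supplies one vector [v] that is the integral over [A] of both [X] and zero;
    testing both with [h] forces [dot h v = 0]. *)
Lemma cond_exp0_dot h A : F A -> (\int[P]_(w in A) (dot h (X w))%:E = 0)%E.
Proof.
move=> FA; have mA := Fm FA; have [v [Xv zv]] := X0.2 A FA.
rewrite (bochner_dot mA _ Xv); last exact: intX.
rewrite -(bochner_dot (X := fun=> 0) mA _ zv).
  by under eq_integral do rewrite dot0r; rewrite integral0.
exact: finite_measure_integrable_cst.
Qed.

Lemma cond_exp0_dot_simple (s : Omega -> H) : simple_rv F s ->
  (\int[P]_w (dot (s w) (X w))%:E = 0)%E.
Proof.
move=> [fs ms]; have ss : simple_rv measurable s by split=> // h; apply: Fm.
rewrite (integral_simple (f := fun u w => dot u (X w)))//; last first.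
  by move=> u; exact: intX.
by rewrite big1// => u _; rewrite setTI cond_exp0_dot.
Qed.

(** A radial truncation by rescaling, [u / (1 + |u| / (n + 1))]: continuous in [u], bounded by both
    [|u|] and [n + 1], and tending to [u]. *)
Let clip (n : nat) (u : H) : H := (1 + harmonic n * `|u|)^-1 *: u.

Let clip_den n (u : H) : 1 <= 1 + harmonic n * `|u|.
Proof. by rewrite lerDl mulr_ge0// harmonic_ge0. Qed.

Let clip_le n u : `|clip n u| <= `|u|.
Proof.
rewrite normrZ ger0_norm ?invr_ge0; last by apply: le_trans (clip_den n u).
by rewrite ler_piMl// invf_le1//; apply: lt_le_trans (clip_den n u).
Qed.

Let clip_bounded n u : `|clip n u| <= n.+1%:R.
Proof.
have d0 : 0 < 1 + harmonic n * `|u| by apply: lt_le_trans (clip_den n u).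
rewrite normrZ gtr0_norm ?invr_gt0// mulrC ler_pdivrMr//.
by rewrite mulrDr mulr1 mulrA /harmonic/= mulfV ?mul1r ?lerDr// pnatr_eq0.
Qed.

Let clip_cvg n (u_ : nat -> H) u :
  u_ k @[k --> \oo] --> u -> clip n (u_ k) @[k --> \oo] --> clip n u.
Proof.
move=> uu; apply: cvgZ => //; apply: cvgV.
  by rewrite gt_eqF//; apply: lt_le_trans (clip_den n u).
by apply: cvgD; [exact: cvg_cst|apply: cvgM; [exact: cvg_cst|exact: cvg_norm]].
Qed.

Let clip_lim u : clip n u @[n --> \oo] --> u.
Proof.
rewrite -[X in _ --> X]scale1r; apply: cvgZ; last exact: cvg_cst.
rewrite -[X in _ --> X]invr1; apply: cvgV; first by [].
rewrite -[X in _ --> X]addr0; apply: cvgD; first exact: cvg_cst.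
rewrite -(mul0r `|u|); apply: cvgM; last exact: cvg_cst.
exact: cvg_harmonic.
Qed.

Let cvg_clip_dot n (u_ v_ : nat -> H) u v :
  u_ k @[k --> \oo] --> u -> v_ k @[k --> \oo] --> v ->
  dot (clip n (u_ k)) (v_ k) @[k --> \oo] --> dot (clip n u) v.
Proof. by move=> uu vv; apply: cvg_dot => //; exact: clip_cvg. Qed.

(* [U] is truncated to the bounded [clip n U], which is a bounded limit of
   simple functions; both limits are taken by dominated convergence. *)
Lemma cond_exp0_orthogonal (U : Omega -> H) : strongly_measurable F U ->
  integrable_rv (fun w => `|U w| ^+ 2) ->
  (\int[P]_w (dot (U w) (X w))%:E = 0)%E.
Proof.
move=> FU iU; have mU := sub_strongly_measurable Fm FU.
have mclip n (V : Omega -> H) : strongly_measurable measurable V ->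
    measurable_fun setT (fun w => (dot (clip n (V w)) (X w))%:E).
  move=> mV; apply/measurable_EFinP.
  apply: (measurable_fun_comp (f := fun u v => dot (clip n u) v)) => //.
  by move=> u_ v_ u v; exact: cvg_clip_dot.
have clip0 n : (\int[P]_w (dot (clip n (U w)) (X w))%:E = 0)%E.
  have [s [ss sU]] := FU.
  have ms k : strongly_measurable measurable (s k).
    apply: (sub_strongly_measurable Fm); exists (fun _ => s k); split=> // w.
    exact: cvg_cst.
  apply: (dominated_integral0 (f_ := fun k w => dot (clip n (s k w)) (X w))
      (g := fun w => n.+1%:R * `|X w|)).
  - by move=> k; exact/measurable_EFinP/mclip.
  - by move=> w; apply: cvg_clip_dot => //; exact: cvg_cst.
  - by apply: integrable_rvZ; exact: integrable_norm_rv.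
  - move=> k w; apply: le_trans (dot_le_norm dotE _ _) _.
    by rewrite ler_wpM2r.
  - move=> k; apply: cond_exp0_dot_simple.
    exact: (simple_rv_comp sF (fun u _ : H => clip n u) (ss k) (ss k)).
apply: (dominated_integral0 (f_ := fun k w => dot (clip k (U w)) (X w))
    (g := fun w => `|U w| ^+ 2 + `|X w| ^+ 2)).
- by move=> k; exact/measurable_EFinP/mclip.
- by move=> w; apply: cvg_dot => //; exact: cvg_cst.
- exact: integrable_rvD.
- move=> k w; apply: le_trans (dot_le_norm dotE _ _) _.
  have := clip_le k (U w); have := sqr_ge0 (`|U w| - `|X w|).
  have := normr_ge0 (X w); have := normr_ge0 (U w); nra.
- by [].
Qed.

End zero_mean.
End conditional.

End orthogonality.

(** * The expected energy *)

Section expected_potential.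
Context (d : measure_display) (Omega : measurableType d) (R : realType)
  (H : normedModType R) (dot : {dot H for @idfun R}) (P : probability Omega R).
Hypothesis dotE : forall h : H, `|h| ^+ 2 = dot h h.
Local Notation integrable_rv f := (P.-integrable setT (EFin \o f)).
Local Notation "'E[ f ]" := (Rintegral P setT f).

(** Turns weighted AM-GM bounds into a product bound, as a substitute for Cauchy-Schwarz in
    expectation. The weight [t = m / s] already gives [3 / 2 m s]. *)
Lemma le_of_amgm (x m s : R) : 0 <= m -> 0 <= s ->
  (forall t, 0 < t -> x <= (t * s ^+ 2 + 2 * m ^+ 2 / t) / 2) -> x <= 2 * m * s.
Proof.
move=> m0 s0 h; have [x0|x0] := leP x 0; first by have := mulr_ge0 m0 s0; lra.
have [s00|s00] := eqVneq s 0.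
  (* In the two degenerate cases the chosen weight yields at most [x / 2] on the right,
     contradicting [0 < x]. *)
  have t0 : 0 < 2 * (m ^+ 2 + 1) / x.
    by rewrite divr_gt0// mulr_gt0// ltr_wpDl// sqr_ge0.
  have := h _ t0; rewrite s00 expr0n/= mulr0 add0r.
  have -> : 2 * m ^+ 2 / (2 * (m ^+ 2 + 1) / x) / 2 =
      x * (m ^+ 2 / (2 * (m ^+ 2 + 1))).
    field; rewrite !gt_eqF//; have := sqr_ge0 m; nra.
  have : m ^+ 2 / (2 * (m ^+ 2 + 1)) <= 1 / 2.
    have := sqr_ge0 m => m2; rewrite ler_pdivrMr; lra.
  nra.
have [m00|m00] := eqVneq m 0.
  have t0 : 0 < x / s ^+ 2 by rewrite divr_gt0// exprn_gt0// lt_def s00.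
  have := h _ t0; rewrite m00 expr0n/= mulr0 mul0r addr0 divfK ?expf_neq0//.
  lra.
have t0 : 0 < m / s by rewrite divr_gt0 ?lt_def ?s00 ?m00.
have := h _ t0.
have -> : (m / s * s ^+ 2 + 2 * m ^+ 2 / (m / s)) / 2 = 3 / 2 * (m * s).
  by field; rewrite s00 m00.
by have := mulr_ge0 m0 s0; lra.
Qed.

Lemma expectation_dot_le (U b : Omega -> H) (m s : R) :
  strongly_measurable measurable U -> strongly_measurable measurable b ->
  integrable_rv (fun w => `|U w| ^+ 2) -> integrable_rv (fun w => `|b w| ^+ 2) ->
  0 <= m -> 0 <= s ->
  'E[fun w => `|U w| ^+ 2] <= 2 * m ^+ 2 -> 'E[fun w => `|b w| ^+ 2] <= s ^+ 2 ->
  'E[fun w => dot (b w) (U w)] <= 2 * m * s.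
Proof.
move=> mU mb iU ib m0 s0 Um bs; apply: le_of_amgm => // t t0.
have iR : integrable_rv (fun w => t / 2 * `|b w| ^+ 2 + (2 * t)^-1 * `|U w| ^+ 2).
  by apply: integrable_rvD; apply: integrable_rvZ.
apply: (@le_trans _ _ ('E[fun w => t / 2 * `|b w| ^+ 2 + (2 * t)^-1 * `|U w| ^+ 2])).
  apply: le_Rintegral => //; first exact: (integrable_dot dotE).
  move=> w _; apply: le_trans (ler_norm _) _.
  apply: le_trans (dot_le_norm dotE _ _) _.
  have := sqr_ge0 (t * `|b w| - `|U w|) => h.
  rewrite -(ler_pM2l (_ : 0 < 2 * t)); last lra.
  rewrite mulrDr [X in _ + X]mulrA divff ?gt_eqF ?mulr_gt0//; nra.
rewrite RintegralD//; [|exact: integrable_rvZ..].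
rewrite !RintegralZl//.
have -> : (t * s ^+ 2 + 2 * m ^+ 2 / t) / 2 =
    t / 2 * s ^+ 2 + (2 * t)^-1 * (2 * m ^+ 2).
  by field; rewrite gt_eqF.
by rewrite lerD// ler_wpM2l// ?invr_ge0; lra.
Qed.

(** [m] bounds the root of the mean energy: the cross term with the bias, at most [2 m r c beta],
    completes the square [(m + r c beta)^2]. The mean of [dot (U w) (xi w)] is supplied as an
    implication because square integrability of [U] is only derived here, from that of [V]. *)
Lemma expected_step (V V' : Omega -> R) (U b xi : Omega -> H)
    (r c sigma beta m : R) :
  0 <= r -> 0 <= c -> 0 <= beta -> 0 <= m ->
  integrable_rv V -> 'E[V] <= m ^+ 2 ->
  measurable_fun setT V' -> (forall w, 0 <= V' w) ->
  strongly_measurable measurable U -> strongly_measurable measurable b ->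
  strongly_measurable measurable xi ->
  (forall w, `|U w| ^+ 2 <= 2 * V w) ->
  integrable_rv (fun w => `|b w| ^+ 2) -> 'E[fun w => `|b w| ^+ 2] <= beta ^+ 2 ->
  integrable_rv (fun w => `|xi w| ^+ 2) -> 'E[fun w => `|xi w| ^+ 2] <= sigma ^+ 2 ->
  (integrable_rv (fun w => `|U w| ^+ 2) -> 'E[fun w => dot (U w) (xi w)] = 0) ->
  (forall w, V' w <= V w + r * dot (c *: (b w + xi w)) (U w)
                     + r ^+ 2 * `|c *: (b w + xi w)| ^+ 2 / 2) ->
  integrable_rv V' /\
  'E[V'] <= (m + r * c * beta) ^+ 2 + r ^+ 2 * c ^+ 2 * sigma ^+ 2.
Proof.
move=> r0 c0 beta0 m0 iV Vm mV' V'0 mU mb mxi UV ib bb ix xs Uxi step.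
have iU : integrable_rv (fun w => `|U w| ^+ 2).
  apply: le_integrable_rv (integrable_rvZ 2 iV); first exact: measurable_fun_norm_sqr.
  by move=> w; rewrite ger0_norm ?sqr_ge0.
have EU : 'E[fun w => `|U w| ^+ 2] <= 2 * m ^+ 2.
  apply: (@le_trans _ _ ('E[fun w => 2 * V w])).
    by apply: le_Rintegral => //; exact: (integrable_rvZ 2 iV).
  by rewrite RintegralZl// ler_pM2l.
have Ub := expectation_dot_le mU mb iU ib m0 beta0 EU bb.
have idb : integrable_rv (fun w => dot (b w) (U w)) by exact: (integrable_dot dotE).
have idx : integrable_rv (fun w => dot (U w) (xi w)) by exact: (integrable_dot dotE).
pose G w := V w + (r * c * dot (b w) (U w) + (r * c * dot (U w) (xi w)
  + (r ^+ 2 * c ^+ 2 * `|b w| ^+ 2 + r ^+ 2 * c ^+ 2 * `|xi w| ^+ 2))).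
have V'G w : V' w <= G w.
  apply: le_trans (step w) _.
  rewrite (dotZl dot) (dotDl dot) (dotC dot (xi w)) normrZ exprMn ger0_norm// /G.
  have h : 0 <= r ^+ 2 * c ^+ 2 by rewrite mulr_ge0 ?sqr_ge0.
  have := ler_wpM2l h (normD_sqr_le dotE (b w) (xi w)); lra.
have i1 : integrable_rv (fun w =>
    r ^+ 2 * c ^+ 2 * `|b w| ^+ 2 + r ^+ 2 * c ^+ 2 * `|xi w| ^+ 2).
  by apply: integrable_rvD; exact: integrable_rvZ.
have i2 : integrable_rv (fun w => r * c * dot (U w) (xi w)
  + (r ^+ 2 * c ^+ 2 * `|b w| ^+ 2 + r ^+ 2 * c ^+ 2 * `|xi w| ^+ 2)).
  by apply: integrable_rvD => //; exact: integrable_rvZ.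
have i3 : integrable_rv (fun w =>
    r * c * dot (b w) (U w) + (r * c * dot (U w) (xi w)
  + (r ^+ 2 * c ^+ 2 * `|b w| ^+ 2 + r ^+ 2 * c ^+ 2 * `|xi w| ^+ 2))).
  by apply: integrable_rvD => //; exact: integrable_rvZ.
have iG : integrable_rv G by exact: integrable_rvD.
have iV' : integrable_rv V'.
  by apply: le_integrable_rv iG => // w; rewrite ger0_norm.
split=> //; apply: (@le_trans _ _ ('E[G])); first exact: le_Rintegral.
rewrite RintegralD// RintegralD//; last exact: integrable_rvZ.
rewrite RintegralD//; last exact: integrable_rvZ.
rewrite RintegralD//; [|exact: integrable_rvZ..].
rewrite !RintegralZl// (Uxi iU) mulr0 add0r.
have rc : 0 <= r * c by rewrite mulr_ge0.
have rc2 : 0 <= r ^+ 2 * c ^+ 2 by rewrite mulr_ge0 ?sqr_ge0.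
have := ler_wpM2l rc Ub; have := ler_wpM2l rc2 bb; have := ler_wpM2l rc2 xs.
lra.
Qed.

(** Noise accumulates as a variance under the root, bias accumulates linearly outside it. *)
Lemma expected_recursion (V : nat -> Omega -> R) (U b xi : nat -> Omega -> H)
    (r beta : nat -> R) (c sigma rho v : R) (K : nat) :
  0 <= c -> 0 <= rho -> 0 <= v ->
  integrable_rv (V 0) -> 'E[V 0] <= v ^+ 2 ->
  (forall k w, 0 <= V k w) ->
  (forall k, (k < K)%N ->
    [/\ 0 <= r k <= rho, 0 <= beta k & measurable_fun setT (V k.+1)] /\
    [/\ strongly_measurable measurable (U k),
        strongly_measurable measurable (b k) &
        strongly_measurable measurable (xi k)] /\
    [/\ forall w, `|U k w| ^+ 2 <= 2 * V k w,
        integrable_rv (fun w => `|b k w| ^+ 2),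
        'E[fun w => `|b k w| ^+ 2] <= beta k ^+ 2,
        integrable_rv (fun w => `|xi k w| ^+ 2) &
        'E[fun w => `|xi k w| ^+ 2] <= sigma ^+ 2] /\
    (integrable_rv (fun w => `|U k w| ^+ 2) ->
      'E[fun w => dot (U k w) (xi k w)] = 0) /\
    (forall w, V k.+1 w <= V k w + r k * dot (c *: (b k w + xi k w)) (U k w)
                     + r k ^+ 2 * `|c *: (b k w + xi k w)| ^+ 2 / 2)) ->
  integrable_rv (V K) /\
  'E[V K] <= (Num.sqrt (v ^+ 2 + (rho * c * sigma) ^+ 2 * K%:R)
              + rho * c * \sum_(k < K) beta k) ^+ 2.
Proof.
move=> c0 rho0 v0 iV0 EV0 V0; elim: K => [|K IH] h.
  rewrite big_ord0 !mulr0 !addr0 sqr_sqrtr ?sqr_ge0//.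
have [iV EV] := IH (fun k kK => h k (ltnW kK)).
have [[/andP[r0 rrho] beta0 mV] [[mU mb mxi] [[UV ib bb ix xs] [Uxi step]]]] :=
  h K (ltnSn K).
set A := v ^+ 2 + (rho * c * sigma) ^+ 2 * K%:R in EV.
set S := \sum_(k < K) beta k in EV.
have A0 : 0 <= A by rewrite addr_ge0 ?sqr_ge0// mulr_ge0 ?sqr_ge0.
have S0 : 0 <= S.
  by apply: sumr_ge0 => k _; have [[_ ? _] _] := h k (ltnW (ltn_ord k)).
have m0 : 0 <= Num.sqrt A + rho * c * S by rewrite addr_ge0 ?sqrtr_ge0 ?mulr_ge0.
have [iV' EV'] := expected_step r0 c0 beta0 m0 iV EV mV (V0 K.+1) mU mb mxi UV
  ib bb ix xs Uxi step.
split=> //; apply: le_trans EV' _.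
rewrite big_ord_recr/= -/S.
have -> : v ^+ 2 + (rho * c * sigma) ^+ 2 * K.+1%:R = A + (rho * c * sigma) ^+ 2.
  by rewrite /A -natr1; ring.
set t := (rho * c * sigma) ^+ 2; have t0 : 0 <= t by exact: sqr_ge0.
have rt : r K ^+ 2 * c ^+ 2 * sigma ^+ 2 <= t.
  rewrite /t !exprMn ler_wpM2r ?sqr_ge0// ler_wpM2r ?sqr_ge0//.
  by rewrite ler_pXn2r ?nnegrE.
have rb : r K * c * beta K <= rho * c * beta K by rewrite !ler_wpM2r.
have sA : Num.sqrt A <= Num.sqrt (A + t) 
  by rewrite ler_wsqrtr// lerDl.
have sAt : Num.sqrt (A + t) ^+ 2 = A + t by rewrite sqr_sqrtr// addr_ge0.
have sA2 : Num.sqrt A ^+ 2 = A by rewrite sqr_sqrtr.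
have B0 : 0 <= rho * c * (S + beta K) by rewrite !mulr_ge0// addr_ge0.
have rb0 : 0 <= r K * c * beta K by rewrite !mulr_ge0.
apply: (@le_trans _ _ ((Num.sqrt A + rho * c * (S + beta K)) ^+ 2 + t)).
  have S1 : 0 <= rho * c * S by rewrite !mulr_ge0.
  rewrite lerD// ler_pXn2r// ?nnegrE; last 2 first.
  - by rewrite addr_ge0.
  - by rewrite addr_ge0 ?sqrtr_ge0.
  by rewrite mulrDr; lra.
(* With [q^2 = p^2 + t], the claim [(p + s)^2 + t <= (q + s)^2] reduces to [p s <= q s]. *)
move: sA sAt sA2 B0; move: (Num.sqrt A) (Num.sqrt (A + t)) (rho * c * _) => p q s.
move=> pq qq pp s0; have := ler_wpM2r s0 pq; lra.
Qed.

(** Replacing [g] by its minimum with [k] leaves the integral unchanged and makes the bound hold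
    everywhere. *)
Lemma integral_le_of_ae (g : Omega -> R) (k : R) : integrable_rv g ->
  {ae P, forall w, g w <= k} -> 'E[g] <= k.
Proof.
move=> ig gk; have mg : measurable_fun setT g.
  exact/measurable_EFinP/(measurable_int P ig).
have mmin : measurable_fun setT (fun w => Order.min (g w) k).
  exact: measurable_minr.
have eq : (\int[P]_w (g w)%:E = \int[P]_w (Order.min (g w) k)%:E)%E.
  apply: ae_eq_integral => //; [exact/measurable_EFinP|exact/measurable_EFinP|].
  by move: gk; apply: filterS => w gw _ /=; rewrite min_l.
have imin : integrable_rv (fun w => Order.min (g w) k).
  have : integrable_rv (fun w => `|g w| + `|k|).
    by apply: integrable_rvD; [exact: integrable_norm|exact: integrable_rv_cst].
  apply: le_integrable_rv => // w.
  by case: (leP (g w) k) => _; rewrite ?lerDl ?lerDr.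
rewrite /Rintegral eq -[leRHS](_ : 'E[fun=> k] = k).
  by apply: le_Rintegral => //; [exact: integrable_rv_cst|move=> w _; rewrite ge_min lexx orbT].
by rewrite Rintegral_cst//= probability_setT mulr1.
Qed.

Lemma noise_second_moment (F : set (set Omega)) (xi : Omega -> H) (sigma : R) :
  sigma_algebra setT F ->
  (exists g, is_real_cond_exp P F (fun w => `|xi w| ^+ 2) g /\
     {ae P, forall w, g w <= sigma ^+ 2}) ->
  integrable_rv (fun w => `|xi w| ^+ 2) /\
  'E[fun w => `|xi w| ^+ 2] <= sigma ^+ 2.
Proof.
move=> sF [g [[ix ig _ Eg] gs]]; split=> //.
have FT : F setT.
  by rewrite -(sigma_algebra_id sF); exact: (@measurableT _ (g_sigma_algebraType F)).
by rewrite /Rintegral Eg//; exact: integral_le_of_ae.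
Qed.

(** An infinite second moment would have an infinite root, so a real bound forces integrability. *)
Lemma rms_fin (X : Omega -> H) (M : R) : strongly_measurable measurable X ->
  (rms P X <= M%:E)%E ->
  integrable_rv (fun w => `|X w| ^+ 2) /\
  'E[fun w => `|X w| ^+ 2] = fine (rms P X) ^+ 2.
Proof.
move=> mX; rewrite /rms unlock.
have I0 : (0 <= \int[P]_w (`|X w| ^+ 2)%:E)%E.
  by apply: integral_ge0 => w _; rewrite lee_fin sqr_ge0.
case E : (\int[P]_w (`|X w| ^+ 2)%:E)%E I0 => [I| |] //= I0 _.
split; last by rewrite /Rintegral E/= sqr_sqrtr.
apply/integrableP; split; first exact/measurable_EFinP/measurable_fun_norm_sqr.
under eq_integral do rewrite /= ger0_norm ?sqr_ge0//.
by rewrite E ltry.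
Qed.

Lemma rms_le (X : Omega -> H) (M : R) : strongly_measurable measurable X ->
  integrable_rv (fun w => `|X w| ^+ 2) -> 0 <= M ->
  'E[fun w => `|X w| ^+ 2] <= M ^+ 2 -> (rms P X <= M%:E)%E.
Proof.
move=> mX iX M0 EX; rewrite /rms unlock.
have -> : M%:E = sqrte ((M ^+ 2)%:E) by rewrite /= sqrtr_sqr ger0_norm.
rewrite lee_sqrt ?lee_fin ?sqr_ge0//.
by rewrite -(fineK (integrable_fin_num measurableT iX)) lee_fin.
Qed.

End expected_potential.

(** * The iteration in momentum form *)

Section ikm.
Context (R : realType) (H : normedModType R) (dot : {dot H for @idfun R}).
Hypothesis dotE : forall h : H, `|h| ^+ 2 = dot h h.

(* Here [D] is the last displacement [x_k - x_(k-1)] and [w (1 + r / 2)] is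
   [omega_(k-1)]. *)
Lemma ikm_step (r u lam al be c w : R) (x D x2 y z Tz e n n2 : H) :
  0 < r -> 0 < w -> u = 3 * r / (2 * (1 + r) * (2 + r)) ->
  lam = c * r * (w * (1 + r / 2)) * u -> lam != 1 ->
  al = (u - lam) / (1 - lam) * be ->
  y = x + al *: D -> z = x + be *: D ->
  x2 = (1 - lam) *: y + lam *: (Tz + e) ->
  n = (be / (w * (1 + r / 2))) *: D -> n2 = (4 / (3 * r) / w) *: (x2 - x) ->
  [/\ z = x + (w * (1 + r / 2)) *: n,
      (1 + r) *: n2 = n - r *: (c *: (z - Tz) - c *: e) &
      x2 = x + (3 / 4 * r * w) *: n2].
Proof.
move=> r0 w0 uE lamE lam1 alE yE zE x2E nE n2E.
have w'0 : 0 < w * (1 + r / 2) by rewrite mulr_gt0//; lra.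
have x2x : x2 = x + (3 / 4 * r * w) *: n2.
  rewrite n2E scalerA (_ : _ * _ = 1) ?scale1r; last by field; rewrite !gt_eqF.
  by rewrite addrC subrK.
have al' : (1 - lam) * al = (u - lam) * be.
  by rewrite alE mulrA mulrCA mulfV ?mulr1// subr_eq0 eq_sym.
split=> //; first by rewrite nE scalerA mulrCA mulfV ?mulr1// gt_eqF.
(* The part [- lam be D] equals [- lam (z - x)] and merges with [lam (Tz + e - x)] into
   [- lam (z - Tz - e)]. *)
have dx : x2 - x = (u * (w * (1 + r / 2))) *: (n - r *: (c *: (z - Tz) - c *: e)).
  have -> : x2 - x = ((1 - lam) * al) *: D + lam *: (Tz + e - x).
    by rewrite x2E yE; apply: (dot_inj dotE) => h; rewrite !(dot_lin dot); ring.
  rewrite al' nE zE lamE; apply: (dot_inj dotE) => h; rewrite !(dot_lin dot).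
  by field; rewrite !gt_eqF//; lra.
(* The choice of [u] makes [u (w (1 + r / 2))] times [4 / (3 r w)] equal to [1 / (1 + r)]. *)
rewrite n2E dx !scalerA (_ : _ * _ = 1) ?scale1r// uE.
by field; rewrite !gt_eqF//; lra.
Qed.
End ikm.

Section bias.
Context (d : measure_display) (Omega : measurableType d) (R : realType)
  (H : normedModType R) (P : probability Omega R).

Lemma rms_ge0 (X : Omega -> H) : (0 <= rms P X)%E.
Proof. exact: sqrte_ge0. Qed.

Lemma total_rms_bias_fin (K : nat) (b : nat -> Omega -> H) (M : R) :
  (total_rms_bias P K.+1 b <= M%:E)%E ->
  (forall k, (k < K)%N -> (rms P (b k.+1) <= M%:E)%E) /\
  \sum_(k < K) fine (rms P (b k.+1)) <= M.
Proof.
rewrite /total_rms_bias big_add1/= big_mkord => h.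
have hk k : (k < K)%N -> (rms P (b k.+1) <= M%:E)%E.
  move=> kK; apply: le_trans h; rewrite (bigD1 (Ordinal kK))//=.
  by rewrite leeDl// sume_ge0// => i _; exact: rms_ge0.
split=> //; move: h; rewrite (eq_bigr (fun k : 'I_K => (fine (rms P (b k.+1)))%:E)).
  by rewrite sumEFin lee_fin.
move=> k _; rewrite fineK// ge0_fin_numE ?rms_ge0//.
by apply: le_lt_trans (hk k (ltn_ord k)) _; rewrite ltry.
Qed.

End bias.

(** * Mean residual at the end of a run *)

Section residual_bound.
Context (R : realType) (a : R) (K : nat) (d : measure_display)
  (Omega : measurableType d) (H : completeNormedModType R)
  (dot : {dot H for @idfun R}) (P : probability Omega R) (T : H -> H)
  (F : nat -> set (set Omega)) (x y z That b xi : nat -> Omega -> H)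
  (sigma B : R) (x0 x1 p : H).
Hypothesis dotE : forall h : H, `|h| ^+ 2 = dot h h.
Hypotheses (neT : nonexpansive T) (Tp : T p = p).
Hypotheses (a_gt0 : 0 < a) (K_gt0 : (0 < K)%N).
Let delta := (a + 1) * ln K.+1%:R / K.+1%:R : R.
Hypothesis delta_le : delta <= 1 / 3.
Hypothesis sigma0 : 0 <= sigma.
Hypothesis iter : ikm_iteration (sp_alpha a K.+1) (sp_beta a K.+1)
  (sp_lambda a K.+1) K.+1 x0 x1 x y z That.
Hypothesis orac : oracle_model P T sigma K.+1 F x y z That b xi.
Hypothesis bias : (total_rms_bias P K.+1 b <= (B * Num.sqrt K.+1%:R)%:E)%E.

Local Notation om := (sp_omega a K.+1).
Local Notation r k := (sp_r a K.+1 k.+1).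
Local Notation c := (sp_scale a K.+1).
Local Notation be k := (sp_beta a K.+1 k.+1).

Let K2 : (2 <= K.+1)%N. Proof. by []. Qed.
Let om0 k : 0 < om k. Proof. exact: sp_omega_gt0. Qed.
Let c0 : 0 < c. Proof. exact: sp_scale_gt0. Qed.
Let r0 k : 0 < r k. Proof. exact: sp_r_gt0. Qed.
Let r1 k : 0 < r k <= 1. Proof. by rewrite r0/= sp_r_le1. Qed.

(** The horizon is [K.+1] and indices are shifted: [n k], [r k] and [be k] are the quantities of
    step [k + 1] of the iteration. *)
Let n k w := (be k / om k) *: (x k.+1 w - x k w).

Let step k w : (k < K.+1)%N ->
  [/\ z k.+1 w = x k.+1 w + om k *: n k w,
      (1 + r k) *: n k.+1 w = n k w - r k *:
        (c *: (z k.+1 w - T (z k.+1 w)) - c *: (b k.+1 w + xi k.+1 w)) &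
      x k.+2 w = x k.+1 w + (3 / 4 * r k * om k.+1) *: n k.+1 w].
Proof.
move=> kK; have [_ _ /(_ k.+1)] := iter; rewrite kK => /(_ isT w)[yE zE xE].
have /andP[_ lam2] := sp_lambda_bounds a_gt0 K2 delta_le k.
have hu : sp_u a K.+1 k.+1 = 3 * r k / (2 * (1 + r k) * (2 + r k)) by [].
have hom := sp_omega_pred a K2 k.
have hl : sp_lambda a K.+1 k.+1 =
    c * r k * (om k.+1 * (1 + r k / 2)) * sp_u a K.+1 k.+1.
  by rewrite -hom; exact: sp_lambdaE.
have hn : n k w = (be k / (om k.+1 * (1 + r k / 2))) *: (x k.+1 w - x k w).
  by rewrite -hom.
rewrite (oracle_answer orac)// -addrA in xE.
rewrite hom.
apply: ikm_step hu hl _ _ yE zE xE hn _ => //.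
by rewrite lt_eqF//; lra.
Qed.

Let resolvents : exists J : nat -> H -> H,
  forall k h, J k h + (c * om k) *: (J k h - T (J k h)) = h.
Proof.
have [J hJ] := boolp.choice (fun k => resolvent_exists neT
  (mulr_ge0 (ltW c0) (ltW (om0 k)))).
by exists J.
Qed.

Let smT := sigma_algebra_measurable Omega.

Let sm k : (k <= K)%N ->
  [/\ strongly_measurable measurable (x k), strongly_measurable measurable (x k.+1)
    & strongly_measurable measurable (z k.+1)] /\
  [/\ strongly_measurable measurable (y k.+1), strongly_measurable measurable (b k.+1)
    & strongly_measurable measurable (xi k.+1)].
Proof.
move=> kK; have [[? ? _] [? ? _ ? ?]] := all_measurable orac (k := k.+1) kK.
by split.
Qed.

Let sm_residual (G : set (set Omega)) (X : Omega -> H) : sigma_algebra setT G ->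
  strongly_measurable G X -> strongly_measurable G (fun w => X w - T (X w)).
Proof.
move=> sG mX; apply: (strongly_measurable_lipschitz sG (k := 2) (f := fun h => h - T h)) => //.
exact: residual_lipschitz.
Qed.

Let sm_n (G : set (set Omega)) k : sigma_algebra setT G ->
  strongly_measurable G (x k) -> strongly_measurable G (x k.+1) ->
  strongly_measurable G (n k).
Proof.
by move=> sG mx mx'; apply: strongly_measurableZ => //; exact: strongly_measurableB.
Qed.

Let adapt k : (k < K)%N ->
  [/\ sigma_algebra setT (F k.+1), F k.+1 `<=` measurable &
    [/\ strongly_measurable (F k.+1) (x k), strongly_measurable (F k.+1) (x k.+1) &
        strongly_measurable (F k.+1) (z k.+1)]].
Proof.
move=> kK; have [? ?] := filtration_sigma orac (k := k.+1) (ltnW kK).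
by have [? ? _ ? _] := adapted orac (k := k.+1) kK.
Qed.

(** The last oracle call only produces [x K.+2], so the energy [V K] reached after the first [K]
    calls is the one needed; adaptedness is available for exactly these calls. *)
Lemma residual_bound (q : Omega -> H) : q = x K.+1 \/ q = y K.+1 \/ q = z K.+1 ->
  (rms P (fun w => q w - T (q w))%R <=
    (30 * (`|x1 - p| / (c * om 0%N)
       + 3 * delta * Num.sqrt K.+1%:R * (sigma + B)))%:E)%E.
Proof.
move=> qE; have [J hJ] := resolvents.
pose g k w := c *: (J k (x k.+1 w) - T (J k (x k.+1 w))).
pose V k w := potential (n k w) (g k w).
pose U k w := n k w + g k w - r k *: (c *: (z k.+1 w - T (z k.+1 w)) - g k w).
have smg G k : sigma_algebra setT G -> strongly_measurable G (x k.+1) ->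
    strongly_measurable G (g k).
  move=> sG mx; apply: strongly_measurableZ => //.
  apply: sm_residual => //; apply: (strongly_measurable_lipschitz sG (k := 1)) => //.
  move=> h h'; rewrite mul1r.
  exact: (resolvent_lipschitz dotE neT (mulr_ge0 (ltW c0) (ltW (om0 k))) (hJ k h) (hJ k h')).
have smU G k : sigma_algebra setT G -> strongly_measurable G (x k) ->
    strongly_measurable G (x k.+1) -> strongly_measurable G (z k.+1) ->
    strongly_measurable G (U k).
  move=> sG mx mx' mz; have mg := smg G k sG mx'; have mn := sm_n sG mx mx'.
  apply: strongly_measurableB => //; first exact: strongly_measurableD.
  apply: strongly_measurableZ => //; apply: strongly_measurableB => //.
  by apply: strongly_measurableZ => //; exact: sm_residual.
have mV k : (k <= K)%N -> measurable_fun setT (V k).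
  move=> kK; have [[mx mx' _] _] := sm kK.
  have mg := smg _ k smT mx'; have mn := sm_n smT mx mx'.
  rewrite /V /potential; apply: measurable_funD; apply: measurable_funM => //.
    by apply: measurable_fun_norm_sqr; exact: strongly_measurableD.
  exact: measurable_fun_norm_sqr.
have V0 k w : 0 <= V k w.
  by rewrite /V /potential addr_ge0// divr_ge0// sqr_ge0.
have VV k w : (k < K.+1)%N -> `|U k w| ^+ 2 <= `|n k w + g k w| ^+ 2 /\
    V k.+1 w <= V k w + r k * dot (c *: (b k.+1 w + xi k.+1 w)) (U k w)
                     + r k ^+ 2 * `|c *: (b k.+1 w + xi k.+1 w)| ^+ 2 / 2.
  move=> kK; have [zE nE xE] := step w kK.
  have hom := sp_omega_pred a K2 k; rewrite hom in zE.
  have hv := hJ k (x k.+1 w); rewrite hom in hv.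
  have := sp_step_le1 a_gt0 K2 delta_le k; rewrite hom => hs.
  exact: (step_descent dotE neT c0 (om0 k.+1) (r1 k) hs zE hv (hJ k.+1 (x k.+2 w)) nE xE).
(* Since [beta_1 = 0], the energy starts with zero momentum, as [potential_init] requires. *)
have n0 w : n 0%N w = 0 by rewrite /n /sp_beta /= mul0r scale0r.
have x1E w : x 1%N w = x1 by have [_ -> _] := iter.
set v := `|x1 - p| / om 0%N.
have v0 : 0 <= v by rewrite divr_ge0// ltW.
have V0v w : V 0%N w <= v ^+ 2.
  rewrite /V n0 /g x1E.
  exact: (potential_init dotE neT c0 (om0 0) Tp (hJ 0%N x1)).
have iV0 : P.-integrable setT (EFin \o V 0%N).
  apply: le_integrable_rv (integrable_rv_cst P (v ^+ 2)); first exact: mV.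
  by move=> w; rewrite ger0_norm.
have EV0 : Rintegral P setT (V 0%N) <= v ^+ 2.
  apply: (@le_trans _ _ (Rintegral P setT (fun=> v ^+ 2))).
    by apply: le_Rintegral => //; [exact: integrable_rv_cst|move=> w _; exact: V0v].
  by rewrite Rintegral_cst//= probability_setT mulr1.
have rho0 : 0 <= 3 * delta.
  by have := r0 0; have := sp_r_le a_gt0 K2 delta_le 0; rewrite -/delta; lra.
have [bfin bsum] := total_rms_bias_fin bias.
have [] := @expected_recursion _ _ _ _ dot P dotE V U (fun k => b k.+1)
  (fun k => xi k.+1) (fun k => r k) (fun k => fine (rms P (b k.+1))) c sigma
  (3 * delta) v K (ltW c0) rho0 v0 iV0 EV0 V0.
  move=> k kK; have [_ [my mb mxi]] := sm (ltnW kK).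
  have [[mx mx' mz] _] := sm (ltnW kK).
  have [sF Fm [fx fx' fz]] := adapt kK.
  have [ix Ex] := noise_second_moment sF (noise_variance orac (k := k.+1) (ltnW kK)).
  have [ib Eb] := rms_fin mb (bfin k kK).
  split; first split.
  - by rewrite ltW// sp_r_le.
  - exact/fine_ge0/rms_ge0.
  - exact: mV.
  split; first by split=> //; exact: smU.
  split; first split=> //.
  - move=> w; apply: le_trans (VV k w (ltnW kK)).1 _.
    by rewrite /V /potential; have := sqr_ge0 `|g k w|; lra.
  - by rewrite Eb.
  split; last by move=> w; exact: (VV k w (ltnW kK)).2.
  (* [U k] is built from [x k], [x k.+1] and [z k.+1], all known to [F k.+1], so the centred noise
     is orthogonal to it. *)
  move=> iU; rewrite /Rintegral (cond_exp0_orthogonal dotE sF Fm mxi ix)//.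
    exact: (noise_unbiased orac (k := k.+1) (ltnW kK)).
  exact: smU.
set M := _ + _; move=> iV EV.
have sK0 := sqrtr_ge0 (K.+1%:R : R).
have rc0 : 0 <= 3 * delta * c by rewrite mulr_ge0// ltW.
have M0 : 0 <= M.
  rewrite addr_ge0 ?sqrtr_ge0// mulr_ge0// sumr_ge0// => k _.
  exact/fine_ge0/rms_ge0.
have MB : M <= v + 3 * delta * c * (sigma + B) * Num.sqrt K.+1%:R.
  (* The root of a sum of two squares is at most the sum of their nonnegative bases; [K] is enlarged
     to [K.+1]. *)
  have h1 : Num.sqrt (v ^+ 2 + (3 * delta * c * sigma) ^+ 2 * K%:R) <=
      v + 3 * delta * c * sigma * Num.sqrt K.+1%:R.
    have p0 : 0 <= 3 * delta * c * sigma * Num.sqrt K.+1%:R.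
      by rewrite mulr_ge0// mulr_ge0.
    rewrite -(@ler_pXn2r _ 2) ?nnegrE ?sqrtr_ge0 ?addr_ge0//.
    rewrite sqr_sqrtr; last by rewrite addr_ge0 ?sqr_ge0// mulr_ge0 ?sqr_ge0.
    apply: (@le_trans _ _ (v ^+ 2 + (3 * delta * c * sigma * Num.sqrt K.+1%:R) ^+ 2)).
      rewrite lerD2l [leRHS]exprMn sqr_sqrtr// ler_wpM2l ?sqr_ge0// ler_nat.
      exact: leqnSn.
    by have := mulr_ge0 v0 p0; lra.
  have h2 : 3 * delta * c * \sum_(k < K) fine (rms P (b k.+1)) <=
      3 * delta * c * (B * Num.sqrt K.+1%:R).
    by rewrite ler_wpM2l.
  by rewrite /M; lra.
have [[_ mxK mzK] [myK _ _]] := sm (leqnn K).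
have lamb := sp_lambda_bounds a_gt0 K2 delta_le K.
have ub := sp_u_bounds a_gt0 K2 K.
set lam := sp_lambda a K.+1 K.+1 in lamb.
set u := sp_u a K.+1 K.+1 in ub.
(* This is the ratio of [alpha] to [beta] at the last step; [u] and [lam] both lie in [(0, 1/2]]. *)
have t1 : `|(u - lam) / (1 - lam)| <= 1.
  have l1 : 0 < 1 - lam by lra.
  rewrite normrM normfV (gtr0_norm l1) ler_pdivrMr// mul1r ler_norml.
  by apply/andP; split; lra.
have mq : strongly_measurable measurable q by case: qE => [->|[->|->]].
have fin w : c ^+ 2 * `|q w - T (q w)| ^+ 2 <= 900 * V K w.
  have [zE _ _] := step w (ltnSn K).
  have [_ _ /(_ K.+1)] := iter; rewrite leqnn => /(_ isT w)[yE zE' _].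
  have yE' : y K.+1 w = x K.+1 w + ((u - lam) / (1 - lam)) *: (z K.+1 w - x K.+1 w).
    by rewrite yE zE' (addrAC (x K.+1 w)) subrr add0r scalerA.
  have := final_residual dotE neT c0 (ltW (om0 K)) (sp_scale_last a_gt0 K2 delta_le)
    t1 zE (hJ K (x K.+1 w)) yE'.
  by case=> hx hy hz; case: qE => [->|[->|->]].
have mres := sm_residual smT mq.
have ires : P.-integrable setT (EFin \o (fun w => `|q w - T (q w)| ^+ 2)).
  apply: le_integrable_rv (integrable_rvZ ((c ^+ 2)^-1 * 900) iV).
    exact: measurable_fun_norm_sqr.
  move=> w; rewrite ger0_norm ?sqr_ge0// -mulrA mulrC ler_pdivlMr ?exprn_gt0//.
  by rewrite mulrC.
apply: (@le_trans _ _ (30 * M / c)%:E); last first.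
  rewrite lee_fin -mulrA ler_pM2l// ler_pdivrMr// mulrDl.
  have -> : `|x1 - p| / (c * om 0%N) * c = v.
    by rewrite /v; field; rewrite !gt_eqF.
  by apply: le_trans MB _; lra.
apply: rms_le => //; first by rewrite divr_ge0 ?(ltW c0)// mulr_ge0.
have -> : (30 * M / c) ^+ 2 = (c ^+ 2)^-1 * 900 * M ^+ 2.
  by field; rewrite gt_eqF.
apply: (@le_trans _ _ (Rintegral P setT (fun w => (c ^+ 2)^-1 * 900 * V K w))).
  apply: le_Rintegral => //; first exact: integrable_rvZ.
  by move=> w _; rewrite -mulrA mulrC ler_pdivlMr ?exprn_gt0// mulrC.
have cc : 0 <= (c ^+ 2)^-1 * 900.
  by apply: mulr_ge0; [rewrite invr_ge0; exact: sqr_ge0|exact: ler0n].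
rewrite (@RintegralZl _ _ _ P setT (V K) _ measurableT iV).
exact: ler_wpM2l.
Qed.

End residual_bound.

(** * Choice of constants and conclusion *)

Theorem mainTheorem2 (R : realType) (a : R) (a_gt0 : 0 < a) :
  exists2 C : R, 0 < C &
  forall D sigma B : R, 0 <= D -> 0 <= sigma -> 0 <= B -> 0 < sigma + B ->
  exists2 eps0 : R, 0 < eps0 &
  forall (H : completeNormedModType R) (dot : {dot H for @idfun R}),
    (forall h : H, `|h| ^+ 2 = dot h h) ->
  forall (T : H -> H), nonexpansive T -> Fix T !=set0 ->
  forall x0 x1 : H, D = inf [set `|x1 - p| | p in Fix T] ->
  forall eps : R, 0 < eps -> eps <= eps0 ->
  forall K : nat, (2 <= K)%N ->
    a <= K%:R * ln 2 / ln K%:R - 1 ->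
    C * (D / eps
         + (sigma + B) ^+ 2 / eps ^+ 2 * ln ((sigma + B) / eps) ^+ 2) <= K%:R ->
  forall (d : measure_display) (Omega : measurableType d)
    (P : probability Omega R) (F : nat -> set (set Omega))
    (x y z That b xi : nat -> Omega -> H),
    ikm_iteration (sp_alpha a K) (sp_beta a K) (sp_lambda a K) K x0 x1
      x y z That ->
    oracle_model P T sigma K F x y z That b xi ->
    (total_rms_bias P K b <= (B * Num.sqrt K%:R)%:E)%E ->
  let residual (v : Omega -> H) := rms P (fun w => v w - T (v w)) in
  (Order.max (Order.max (residual (x K)) (residual (y K))) (residual (z K))
     <= eps%:E)%E.
Proof.
(* [180 = 30 * 3 * 2]: the factor [30] and the [3 delta] of [residual_bound], doubled to leave
   [eps / 2] for the noise. *)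
have [M ME M1] : exists2 M, M = 180 * (a + 1) & 1 <= M.
  by exists (180 * (a + 1)); [exact: erefl|lra].
have a10 : 0 < 1 + 1 / a by rewrite addr_gt0// divr_gt0.
(* The distance term carries [30 * 4 = 120] times [1 + 1 / a]; this is [A / 4], well within the
   other [eps / 2]. *)
have [A AE A0] : exists2 A, A = 480 * (1 + 1 / a) & 0 < A.
  by exists (480 * (1 + 1 / a)); [exact: erefl|lra].
have M20 : 0 < (6 * M) ^+ 2 by apply: exprn_gt0; lra.
have [C CE C0] : exists2 C, C = (6 * M) ^+ 2 + A & 0 < C.
  by exists ((6 * M) ^+ 2 + A) => //; exact: addr_gt0.
exists C => // D sigma B D0 sigma0 B0; set s := sigma + B => s0.
(* Ensures [X = s / eps >= 6 M], the range in which [ln_div_sqrt_le] applies. *)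
exists (s / (6 * M)); first by rewrite divr_gt0//; lra.
move=> H dot dotE T neT FixT x0 x1 DE eps eps0 epsle [|K]// K2 _ hK.
move=> d Omega P F x y z That b xi iter orac bias.
set k : R := K.+1%:R in hK bias.
have k0 : 0 < k by rewrite /k ltr0n.
pose X := s / eps.
have MX : 6 * M <= X.
  rewrite /X ler_pdivlMr//; move: epsle; rewrite ler_pdivlMr; lra.
have Ck : C * (D / eps + X ^+ 2 * ln X ^+ 2) <= k by rewrite /X expr_div_n.
(* Lets the noise term of the lower bound on [K] absorb the additive [1] in [C2], which comes from
   choosing [p] only within [eps] of the infimum. *)
have X1 : 1 <= X ^+ 2 * ln X ^+ 2.
  have X2 : 2 <= X by lra.
  have lX : 1 / 2 <= ln X.
    have -> : ln X = - ln (1 + - (1 - X^-1)).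
      by rewrite opprB addrC subrK lnV ?posrE ?opprK//; lra.
    have X0 : X^-1 <= 1 / 2 by rewrite -[leLHS]mul1r ler_pdivrMr; lra.
    have : ln (1 + - (1 - X^-1)) <= - (1 - X^-1).
      apply: le_ln1Dx; have : 0 < X^-1 by rewrite invr_gt0; lra.
      lra.
    lra.
  rewrite -exprMn expr_ge1//; nra.
have De : 0 <= D / eps by rewrite divr_ge0// ltW.
have C1 : (6 * M) ^+ 2 * (X ^+ 2 * ln X ^+ 2) <= k.
  apply: le_trans Ck; apply: ler_pM; [exact: ltW|lra| |lra].
  by rewrite CE lerDl ltW.
have C2 : A * (D / eps + 1) <= k.
  apply: le_trans Ck; apply: ler_pM; [exact: ltW|lra| |lra].
  by rewrite CE lerDr ltW.
have lnk := ln_div_sqrt_le M1 MX k0 C1.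
have sk0 : 0 < Num.sqrt k by rewrite sqrtr_gt0.
have sk2 : Num.sqrt k ^+ 2 = k by rewrite sqr_sqrtr// ltW.
(* The standing assumption on the schedule: [sqrt k >= 6 M] and [ln k <= 2 sqrt k] make the quotient
   small. *)
have delta_le : (a + 1) * ln k / k <= 1 / 3.
  rewrite ler_pdivrMr//.
  have : 6 * M <= Num.sqrt k.
    rewrite -(@ler_pXn2r _ 2) ?nnegrE ?(ltW sk0)//; last lra.
    by rewrite sk2; apply: le_trans C1; exact: ler_peMr (ltW M20) X1.
  rewrite ME => MS; apply: (@le_trans _ _ ((a + 1) * (2 * Num.sqrt k))).
    by rewrite ler_wpM2l ?ln_le_sqrt//; lra.
  have : 6 * (180 * (a + 1)) * Num.sqrt k <= k by rewrite -[leRHS]sk2 expr2 ler_pM2r.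
  by have := mulr_gt0 a_gt0 sk0; lra.
have hasinf : has_inf [set `|x1 - p| | p in Fix T].
  split; first by case: FixT => p Tp; exists `|x1 - p|, p.
  by exists 0 => _ [p _ <-].
(* A fixed point with [|x1 - p| < D + eps], so that attainment of the infimum need not be argued. *)
have [_ [p Tp <-] pD] := inf_adherent eps0 hasinf; rewrite -DE in pD.
have K0 : (0 < K)%N by [].
have bound q : q = x K.+1 \/ q = y K.+1 \/ q = z K.+1 ->
    (rms P (fun w => q w - T (q w))%R <= eps%:E)%E.
  move=> hq; apply: le_trans (residual_bound dotE neT Tp a_gt0 K0 delta_le
    sigma0 iter orac bias hq) _.
  rewrite lee_fin sp_scale_omega0// -/k -/s.
  have e1 : 30 * (`|x1 - p| / (k / (4 * (1 + 1 / a)))) <= eps / 2.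
    have -> : 30 * (`|x1 - p| / (k / (4 * (1 + 1 / a)))) = A / 4 * `|x1 - p| / k.
      rewrite AE; move: a10 => /lt0r_neq0; move: (1 + 1 / a) => t t0.
      by field; rewrite t0 gt_eqF.
    rewrite ler_pdivrMr//.
    have De1 : A * (D + eps) <= eps * k.
      have -> : A * (D + eps) = eps * (A * (D / eps + 1)).
        by field; rewrite gt_eqF.
      by rewrite ler_pM2l.
    have : A * `|x1 - p| <= A * (D + eps) by rewrite ler_pM2l// ltW.
    by have := mulr_gt0 eps0 k0; lra.
  have e2 : 30 * (3 * ((a + 1) * ln k / k) * Num.sqrt k * s) <= eps / 2.
    have kE L S t : 0 < S -> t = S ^+ 2 ->
        30 * (3 * ((a + 1) * L / t) * S * s) = M * s * L / S / 2.
      by move=> S0 ->; rewrite ME; field; rewrite gt_eqF.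
    rewrite (kE _ _ _ sk0 (esym sk2)) ler_pM2r ?invr_gt0// ler_pdivrMr//.
    have -> : s = X * eps by rewrite /X divfK// gt_eqF.
    by have := ler_wpM2l (ltW eps0) lnk; lra.
  by rewrite mulrDr; apply: le_trans (lerD e1 e2) _; rewrite -splitr.
rewrite /= !ge_max; apply/andP; split; last by apply: (bound (z K.+1)); right; right.
by apply/andP; split; [apply: (bound (x K.+1)); left|apply: (bound (y K.+1)); right; left].
Qed.
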